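(* Let $I=[0,T]$ be a bounded time interval and let $H$ be a separable Hilbert space. Let $f:H\to H$ be a Lipschitz function admitting at most a linear growth, and let $r>0$ be a fixed real. Let $C$ be a nonempty closed $(r,f)$-prox-regular subset of $H$. Then for all $u_0\in C$, the system $$\dot u(t)+\mathrm{N}(C,u(t))\ni f(u(t))\ \text{ for a.e. } t\in I,\qquad u(0)=u_0,$$ has one and only one absolutely continuous solution $u$, and for all $t\in I$, $u(t)\in C$.
   Context: Hilbert spaces are real; the norm of $H$ is $\|\cdot\|$. Projection: for $C\subset H$ closed and $x\in H$, $P_C(x):=\{y\in C:\ \|x-y\|=d(x,C)\}$ (a possibly empty or multi-element set; when it is a singleton it is identified with its element). Proximal normal cone: for $x\in C$, $\mathrm{N}(C,x):=\{v\in H:\ \exists s>0,\ x\in P_C(x+sv)\}$. For $x\in C$ and $r>0$, $\Gamma^r(C,x):=\{v\in H:\ x\in P_C(x+rv)\}$. Directional prox-regularity: for a mapping $f:H\to H$, a closed set $C$ is $(r,f)$-prox-regular if for all $x\in C$ and all $s\in(0,r)$: (a) the projection $z:=P_C\left(x+s\frac{f(x)}{\|f(x)\|}\right)$ is well-defined (a single point); and (b) with $y:=x+s\frac{f(x)}{\|f(x)\|}$, one has $\frac{y-z}{\|y-z\|}\in\Gamma^r(C,z)$. By convention $\frac{v}{\|v\|}:=0$ if $v=0$. At most linear growth: there exists $L>0$ with $\|f(x)\|\le L(1+\|x\|)$ for all $x\in H$. *)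

(* Defs.v *)
From HB Require Import structures.
From mathcomp Require Import all_boot all_order all_algebra.
From mathcomp Require Import all_classical all_reals all_analysis.

Set Implicit Arguments.
Unset Strict Implicit.
Unset Printing Implicit Defensive.

Import Order.TTheory GRing.Theory Num.Theory.
Import numFieldNormedType.Exports.

Local Open Scope classical_set_scope.
Local Open Scope ring_scope.

(* The norm is required to come from the inner product, so a completeNormedModType
   with such a form is a real Hilbert space. *)
Definition norm_from_dot (R : realType) (H : normedModType R)
  (ip : {dot H for (@idfun R)}) : Prop :=
  forall x : H, `|x| = Num.sqrt (ip x x).

Definition separable (T : topologicalType) : Prop :=
  exists D : set T, countable D /\ dense D.

Section ProximalCalculus.
Variables (R : realType) (H : normedModType R).
Implicit Types (C : set H) (f : H -> H) (x v : H) (r : R).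

(* Only meaningful for nonempty C: the infimum of the empty set is 0 in R. *)
Definition dist_to C x : R := inf [set `|x - y| | y in C].

Definition proj C x : set H := [set y | C y /\ `|x - y| = dist_to C x].

(* Empty when x lies outside C, since proj C _ is a subset of C. *)
Definition proximal_normal C x : set H :=
  [set v | exists s : R, 0 < s /\ proj C (x + s *: v) x].

Definition Gamma r C x : set H := [set v | proj C (x + r *: v) x].

(* Yields 0 at v = 0. *)
Definition normalize v : H := `|v|^-1 *: v.

Definition prox_regular r f C : Prop :=
  forall x, C x -> forall s : R, 0 < s < r ->
    let y := x + s *: normalize (f x) in
    exists z : H, proj C y = [set z] /\ Gamma r C z (normalize (y - z)).

Definition linear_growth f : Prop :=
  exists L : R, 0 < L /\ forall x, `|f x| <= L * (1 + `|x|).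

End ProximalCalculus.

Section Solutions.
Variables (R : realType) (H : normedModType R).

Definition absolutely_continuous (a b : R) (u : R -> H) : Prop :=
  forall e : R, 0 < e -> exists d : R, 0 < d /\
    forall (n : nat) (s t : 'I_n -> R),
      (forall i, [/\ a <= s i, s i <= t i & t i <= b]) ->
      trivIset [set: 'I_n] (fun i => `]s i, t i[%classic) ->
      \sum_(i < n) (t i - s i) < d ->
      \sum_(i < n) `|u (t i) - u (s i)| < e.

(* A map on [0, T] is represented by any extension to R: the derivative at interior
   points depends only on the values on [0, T], and the endpoints are negligible. *)
Definition is_solution (T : R) (f : H -> H) (C : set H) (u0 : H) (u : R -> H)
  : Prop :=
  [/\ absolutely_continuous 0 T u,
      {ae (@lebesgue_measure R), forall t : R, `[0, T]%classic t ->
         derivable u t 1 /\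
         [set 'D_1 u t + v | v in proximal_normal C (u t)] (f (u t))}
    & u 0 = u0].

End Solutions.

(* Main.v *)
Require Import Defs.
From HB Require Import structures.
From mathcomp Require Import all_boot all_order all_algebra.
From mathcomp Require Import all_classical all_reals all_analysis.
From mathcomp Require Import ring lra.

Import Order.TTheory GRing.Theory Num.Theory.
Import numFieldNormedType.Exports.

Local Open Scope classical_set_scope.
Local Open Scope ring_scope.

Set Implicit Arguments.
Unset Strict Implicit.
Unset Printing Implicit Defensive.

(** Write a solution as [u' = f(u) - v] with [v] a proximal normal to [C] at [u].

Uniqueness.  A proximal normal [v] obeys a quadratic inequality
[2 s <v, y - x> <= |y - x|^2] on [C] with some [s > 0] depending on [v], which is
too weak for a Gronwall argument.  For the normals produced by a solution the
constant becomes uniform.  Where [u] is derivable, both [u'] and [- u'] are tangent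
to [C], so that [v] is orthogonal to [u'] and [|v| <= |f(u)|].  For small [k] the
point [u(t + k)] competes with the projection of [u + k f(u)] on [C]; comparing
the two shows that the residual of this projection, divided by [k], converges to
[v].  Directional prox-regularity controls these residuals with the constant [r],
hence it also controls [v] ([velocity_hyponormal]).  The field [f - v] is therefore
one-sided Lipschitz along bounded solutions ([one_sided_lipschitz]), and the squared
distance of two solutions satisfies a differential inequality almost everywhere.
The comparison principle [gronwall_ae] for absolutely continuous functions
concludes.

Existence.  The catching-up algorithm projects [x + h f(x)] on [C] at each step of
length [h].  The same one-sided estimate shows that its polygons form a Cauchy
family ([approx_compare]); the limit [u] is Lipschitz, stays in [C], and satisfies
a variational inequality against every uniform normal of [C] ([limit_evolves]).

It remains to differentiate [u] in a Hilbert space.  As in the theory of semigroups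
generated by monotone operators, this follows from the dynamics, with countably many
exceptional times.  For [x] in [C] the quotients [(P_C(x + s f(x)) - x) / s]
play the role of Yosida approximations and converge, as [s] tends to 0, to a
projected velocity [g(x)] ([projected_velocity_exists]).  The variational inequality
tested at [P_C(x + s f(x))] bounds the scalar product of the difference quotients of
[u] with [g] from below, while their norm is bounded by that of [g]; a vector of norm
at most [|g|] whose product with [g] is at least [|g|^2] is [g], so that [u] has the
right derivative [g(u)] everywhere ([evolution_right_deriv]).  The translates of [u]
are again trajectories, whence [exp(- k t) |g(u(t))|] is nonincreasing
([velocity_norm_growth]).  At each continuity point of this monotone function the same
argument applied to left quotients gives the two-sided derivative. *)

(** * Comparison principle for absolutely continuous functions *)

(** Induction along a real interval; it stands for the compactness argument in the
comparison principle below. *)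
Lemma real_induction {R : realType} (a b : R) (Q : R -> Prop) :
  Q a ->
  (forall t, a <= t < b -> Q t ->
    exists d : R, 0 < d /\ forall h, 0 < h < d -> t + h <= b -> Q (t + h)) ->
  (forall t, a < t <= b -> (forall s, a <= s < t -> Q s) -> Q t) ->
  forall t, a <= t <= b -> Q t.
Proof.
move=> Qa Qstep Qlim t0 /andP[at0 t0b].
pose S : set R := [set s | a <= s <= t0 /\ forall x, a <= x <= s -> Q x].
have Sa : S a.
  split; first by rewrite lexx at0.
  by move=> x /andP[ax xa]; have -> : x = a by apply/eqP; rewrite eq_le xa ax.
have ubS : ubound S t0 by move=> s [/andP[]].
have hsS : has_sup S by split; [exists a | exists t0].
pose c := sup S.
have ac : a <= c by apply: ub_le_sup => //; exists t0.
have ct0 : c <= t0 by apply: ge_sup => //; exists a.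
have below s : a <= s < c -> Q s.
  move=> /andP[as_ sc].
  have [x [_ Sx] cx] := sup_adherent (eps := c - s) ltac:(by rewrite subr_gt0) hsS.
  apply: Sx; rewrite as_ /=; rewrite -/c in cx; lra.
have Qc : Q c.
  move: ac; rewrite le_eqVlt => /predU1P[<-//|ac].
  by apply: Qlim; rewrite // ac (le_trans ct0).
have upto x : a <= x <= c -> Q x.
  move=> /andP[ax]; rewrite le_eqVlt => /predU1P[->//|xc].
  by apply: below; rewrite ax.
move: ct0; rewrite le_eqVlt => /predU1P[<-//|ct0].
have [d [d0 Qd]] := Qstep c ltac:(by rewrite ac (lt_le_trans ct0)) Qc.
pose k := Num.min (d / 2) (t0 - c).
have k0 : 0 < k by rewrite lt_min divr_gt0//= subr_gt0.
have [kd kt] : k <= d / 2 /\ k <= t0 - c by rewrite !ge_min !lexx orbT.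
suff Sck : S (c + k).
  have : c + k <= c by apply: ub_le_sup => //; exists t0.
  by rewrite gerDl leNgt k0.
split; first by apply/andP; split; lra.
move=> x /andP[ax xck]; have [xc|cx] := leP x c; first by apply: upto; rewrite ax.
have -> : x = c + (x - c) by lra.
by apply: Qd; [apply/andP; split; lra | lra].
Qed.

Section Gronwall.
Context {R : realType}.
Notation mu := (@lebesgue_measure R).

(** The supremum of this set is the part of the variation of [phi] that is carried by [U]
up to time [t]: it is small when [phi] is absolutely continuous and [U] has small measure. *)
Definition covered_sums (phi : R -> R) (U : set R) (a t : R) : set R :=
  [set x | exists (n : nat) (p q : 'I_n -> R),
    [/\ forall i, [/\ a <= p i, p i <= q i, q i <= t & `[p i, q i] `<=` U],
        trivIset [set: 'I_n] (fun i => `]p i, q i[%classic)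
      & x = \sum_(i < n) `|phi (q i) - phi (p i)|] ].

Lemma covered_sums0 phi U a t : covered_sums phi U a t 0.
Proof.
exists 0%N, (fun=> 0), (fun=> 0); split; first by case.
  by move=> [] //.
by rewrite big_ord0.
Qed.

Lemma sum_length_le n (p q : 'I_n -> R) (U : set R) : open U ->
  (forall i, p i <= q i /\ `[p i, q i] `<=` U) ->
  trivIset [set: 'I_n] (fun i => `]p i, q i[%classic) ->
  ((\sum_(i < n) (q i - p i))%:E <= mu U)%E.
Proof.
move=> oU pq tI.
have -> : ((\sum_(i < n) (q i - p i))%:E = \sum_(i < n) mu `]p i, q i[)%E.
  rewrite -sumEFin; apply: eq_bigr => i _.
  have [piqi _] := pq i.
  rewrite lebesgue_measure_itv/= lte_fin.
  have [lt_pq|] := ltP (p i) (q i); first by rewrite EFinB.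
  move=> qp; have -> : p i = q i by apply/eqP; rewrite eq_le piqi.
  by rewrite subrr.
rewrite -measure_bigsetU_ord //.
apply: le_measure; rewrite ?inE.
- by apply: bigsetU_measurable => i _; exact: measurable_itv.
- exact: measurable_realfun.open_measurable.
- apply: (big_ind (fun V => V `<=` U)) => //.
    by move=> V1 V2 V1U V2U x [/V1U|/V2U].
  move=> i _; have [_] := pq i; apply: subset_trans.
  exact: subset_itv_oo_cc.
Qed.

(** The new interval takes the index 0; the old ones are shifted. *)
Lemma covered_sumsS phi U a t h x : 0 <= h -> a <= t -> `[t, t + h] `<=` U ->
  covered_sums phi U a t x ->
  covered_sums phi U a (t + h) (x + `|phi (t + h) - phi t|).
Proof.
move=> h0 at_ thU [n [p [q [pq tI ->]]]].
pose p' (i : 'I_n.+1) := if unlift ord0 i is Some j then p j else t.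
pose q' (i : 'I_n.+1) := if unlift ord0 i is Some j then q j else t + h.
exists n.+1, p', q'; split.
- move=> i; rewrite /p' /q'; case: unliftP => [j _|_].
    by have [? ? ? ?] := pq j; split => //; lra.
  by split => //; lra.
- move=> i j _ _ [x0 []]; rewrite /p' /q' /=.
  case: unliftP => [i' ->|->]; case: unliftP => [j' ->|->] //=.
  + by move=> xi xj; congr (lift _ _); apply: tI => //; exists x0.
  + rewrite !in_itv/= => /andP[_ xq] /andP[tx _].
    by have [_ _ qt _] := pq i'; exfalso; lra.
  + rewrite !in_itv/= => /andP[tx _] /andP[_ xq].
    by have [_ _ qt _] := pq j'; exfalso; lra.
- rewrite big_ord_recl addrC; congr (_ + _).
    by rewrite /p' /q' unlift_none.
  by apply: eq_bigr => i _; rewrite /p' /q' liftK.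
Qed.

Lemma covered_sums_le phi U a t t' : t <= t' ->
  covered_sums phi U a t `<=` covered_sums phi U a t'.
Proof.
move=> tt' x [n [p [q [pq tI ->]]]]; exists n, p, q; split => //.
by move=> i; have [? ? ? ?] := pq i; split => //; lra.
Qed.

Lemma AC_continuous (H : normedModType R) (a b : R) (u : R -> H) :
  absolutely_continuous a b u ->
  forall e : R, 0 < e -> exists d : R, 0 < d /\
    forall s t, a <= s -> s <= t -> t <= b -> t - s < d -> `|u t - u s| < e.
Proof.
move=> uAC e e0; have [d [d0 Hd]] := uAC e e0.
exists d; split => // s t as_ st tb tsd.
have := Hd 1%N (fun=> s) (fun=> t) ltac:(by []).
rewrite !big_ord1; apply=> //.
by move=> i j _ _ _; rewrite (ord1 i) (ord1 j).
Qed.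

(** The exceptional set lies in an open set [U] of small measure.  By real induction
[phi t] stays below [exp(L (t - a)) (A + (D + e) (t - a) + W t)], where [W t] is the
supremum of the increments of [phi] inside [U]: outside [U] the right Dini bound
propagates the inequality, because [1 + x <= exp x]; inside [U] the growth of [phi] is
absorbed by that of [W].  Absolute continuity makes [W] arbitrarily small. *)
Lemma gronwall_ae (phi : R -> R) (a b L D A : R) (N : set R) :
  a <= b -> 0 <= L -> 0 <= D -> 0 <= A ->
  absolutely_continuous a b phi -> mu.-negligible N ->
  (forall t, a <= t < b -> ~ N t -> forall e, 0 < e -> exists d : R, 0 < d /\
    forall h, 0 < h < d -> t + h <= b ->
      phi (t + h) <= phi t + h * (L * phi t + D + e)) ->
  phi a <= A -> phi b <= expR (L * (b - a)) * (A + D * (b - a)).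
Proof.
move=> ab L0 D0 A0 phiAC [N' [mN' N'0 NN']] phiD phia.
suff bound e : 0 < e ->
    phi b <= expR (L * (b - a)) * (A + (D + e) * (b - a) + e).
  apply/ler_addgt0Pr => e e0.
  set E := expR _.
  have E0 : 0 < E by exact: expR_gt0.
  have ba : 0 < b - a + 1 by lra.
  have k0 : 0 < e / (E * (b - a + 1)) by rewrite divr_gt0// mulr_gt0.
  apply: le_trans (bound _ k0) _; rewrite -/E.
  set k := e / _ in k0 *.
  have -> : e = E * (k * (b - a + 1)).
    by rewrite /k mulrCA -mulrA mulVf ?mulr1// mulf_neq0 ?gt_eqF.
  by rewrite -mulrDr ler_pM2l//; lra.
move=> e0.
have [d [d0 phid]] := phiAC e e0.
have [U [oU N'U mU]] : exists U : set R,
    [/\ open U, N' `<=` U & (mu (U `\` N') < d%:E)%E].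
  apply: lebesgue_regularity_outer => //.
  by rewrite [X in (X < _)%E](N'0 : mu N' = 0%E) ltry.
(* The regularity theorem controls [U] minus [N'], and [N'] is null. *)
have {}mU : (mu U < d%:E)%E.
  rewrite (measureDI mu (measurable_realfun.open_measurable oU) mN').
  rewrite [X in (_ + X < _)%E](_ : _ = 0%E) ?adde0//.
  apply/eqP; rewrite -measure_le0 -N'0.
  apply: le_measure; [rewrite inE | by rewrite inE | exact: subIsetr].
  by apply: measurableI => //; exact: measurable_realfun.open_measurable.
(* [W] pays for the growth of [phi] on [U], the Dini bound for the rest. *)
pose W t := sup (covered_sums phi U a t).
have sums_lt x t : t <= b -> covered_sums phi U a t x -> x < e.
  move=> tb /(covered_sums_le tb) [n [p [q [pq tI ->]]]].
  apply: phid => //; first by move=> i; have [] := pq i.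
  rewrite -lte_fin; apply: le_lt_trans mU; apply: sum_length_le => // i.
  by have [] := pq i.
have sums_has_ub t : t <= b -> has_ubound (covered_sums phi U a t).
  by move=> tb; exists e => x /(sums_lt _ _ tb)/ltW.
have sums_has_sup t : t <= b -> has_sup (covered_sums phi U a t).
  by move=> tb; split; [exists 0; exact: covered_sums0 | exact: sums_has_ub].
have W0 t : t <= b -> 0 <= W t.
  by move=> tb; apply: ub_le_sup; [exact: sums_has_ub | exact: covered_sums0].
have We t : t <= b -> W t <= e.
  move=> tb; apply: ge_sup; first by exists 0; exact: covered_sums0.
  by move=> x /(sums_lt _ _ tb)/ltW.
have Wmono s t : s <= t -> t <= b -> W s <= W t.
  move=> st tb; apply: ge_sup; first by exists 0; exact: covered_sums0.
  move=> x /(covered_sums_le st) xt; apply: ub_le_sup => //.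
  exact: sums_has_ub.
have Wstep t h : 0 <= h -> a <= t -> t + h <= b -> `[t, t + h] `<=` U ->
    W t + `|phi (t + h) - phi t| <= W (t + h).
  move=> h0 at_ thb thU; rewrite -lerBrDr.
  apply: ge_sup; first by exists 0; exact: covered_sums0.
  move=> x xt; rewrite lerBrDr; apply: ub_le_sup; first exact: sums_has_ub.
  exact: covered_sumsS.
pose E t := expR (L * (t - a)).
pose F t := A + (D + e) * (t - a) + W t.
have Emono s t : s <= t -> E s <= E t.
  by move=> st; rewrite ler_expR ler_wpM2l// lerD2r.
have E1 t : a <= t -> 1 <= E t.
  by move=> at_; rewrite -expR0 ler_expR mulr_ge0// subr_ge0.
have F0 t : a <= t -> t <= b -> 0 <= F t.
  move=> at_ tb; have := W0 _ tb => ?.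
  by rewrite /F !addr_ge0// mulr_ge0 ?subr_ge0// addr_ge0// ltW.
have Fmono s t : s <= t -> t <= b -> F s <= F t.
  move=> st tb; have := Wmono _ _ st tb => ?.
  by rewrite /F lerD// lerD2l ler_wpM2l ?lerD2r// addr_ge0// ltW.
suff /(_ b) : forall t, a <= t <= b -> phi t <= E t * F t.
  rewrite ab lexx => /(_ isT)/le_trans; apply.
  by rewrite ler_pM2l ?expR_gt0// /F lerD2l We.
apply: real_induction.
- apply: (le_trans phia).
  rewrite /E /F subrr !mulr0 expR0 mul1r addr0 lerDl.
  exact: W0.
- move=> t /andP[at_ tb] Qt.
  have [Ut|nUt] := pselect (U t).
  + have [k /= k0 kU] := oU _ Ut.
    exists k; split => // h /andP[h0 hk] thb.
    have /(Wstep _ _ (ltW h0) at_ thb) Wh : `[t, t + h] `<=` U.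
      move=> x /=; rewrite in_itv/= => /andP[tx xt]; apply: kU => /=.
      by rewrite ltr_norml; apply/andP; split; lra.
    have tth : t <= t + h by lra.
    apply: (@le_trans _ _ (E t * (F t + `|phi (t + h) - phi t|))).
      rewrite mulrDr; have := ler_norm (phi (t + h) - phi t) => ?.
      have : `|phi (t + h) - phi t| <= E t * `|phi (t + h) - phi t|.
        by rewrite ler_peMl// E1.
      lra.
    apply: (@le_trans _ _ (E t * F (t + h))); last first.
      by rewrite ler_wpM2r ?Emono// F0//; lra.
    rewrite ler_pM2l ?expR_gt0// /F.
    have : 0 <= (D + e) * h by rewrite mulr_ge0 ?ltW// ltr_wpDl.
    lra.
  + have [k [k0 Hk]] := phiD t ltac:(by rewrite at_) (fun Nt => nUt (N'U _ (NN' _ Nt))) _ e0.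
    exists k; split => // h hk thb; apply: (le_trans (Hk h hk thb)).
    have /andP[h0 _] := hk.
    have tth : t <= t + h by lra.
    have Eh : E t * (1 + L * h) <= E (t + h).
      rewrite /E (_ : L * (t + h - a) = L * (t - a) + L * h); last by ring.
      by rewrite expRD ler_pM2l ?expR_gt0// expR_ge1Dx.
    have FF : F t + (D + e) * h <= F (t + h).
      by rewrite /F; have := Wmono _ _ tth thb; lra.
    have Lh : 0 <= L * h by rewrite mulr_ge0// ltW.
    have De : 0 <= (D + e) * h by rewrite mulr_ge0 ?ltW// ltr_wpDl.
    have step1 : phi t * (1 + L * h) <= E t * F t * (1 + L * h).
      by rewrite ler_wpM2r//; lra.
    have step2 : E t * F t * (1 + L * h) <= E (t + h) * F t.
      by rewrite mulrAC ler_wpM2r// F0// ltW.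
    have step3 : (D + e) * h <= E (t + h) * ((D + e) * h).
      by rewrite ler_peMl// E1//; lra.
    have step4 : E (t + h) * (F t + (D + e) * h) <= E (t + h) * F (t + h).
      by rewrite ler_pM2l ?expR_gt0.
    lra.
- move=> t /andP[at_ tb] below.
  apply/ler_addgt0Pr => k k0.
  have [dd [dd0 Hd]] := AC_continuous phiAC k0.
  pose s := Num.max a (t - dd / 2).
  have sa : a <= s by rewrite le_max lexx.
  have st : s < t by rewrite gt_max at_ /=; lra.
  have sdd : t - s < dd by have : t - dd / 2 <= s by [rewrite le_max lexx orbT]; lra.
  have := Hd s t sa (ltW st) tb sdd.
  have Qs := below s ltac:(by rewrite sa).
  have : E s * F s <= E t * F t.
    by rewrite ler_pM ?expR_ge0 ?F0 ?Emono ?Fmono// ?ltW// (lt_le_trans st).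
  rewrite ltr_norml => ? /andP[_ ?]; lra.
Qed.

End Gronwall.

(** * Inner products *)

Lemma cvg_sqr_norm {R : realType} {H : normedModType R} (a : nat -> H) (l : H) :
  a @ \oo --> l -> (fun n => `|a n| ^+ 2) @ \oo --> (`|l| ^+ 2 : R).
Proof. by move=> /cvg_norm al; rewrite expr2; apply: cvgM. Qed.

Section InnerProduct.
Context {R : realType} {H : normedModType R} (ip : {dot H for (@idfun R)}).
Hypothesis Hip : norm_from_dot ip.
Implicit Types (x y z : H) (a : R).

Lemma ipC x y : ip x y = ip y x.
Proof. by rewrite hermC expr0 mul1r. Qed.

Lemma ipDl x y z : ip (x + y) z = ip x z + ip y z.
Proof. exact: linearDl. Qed.

Lemma ipDr x y z : ip z (x + y) = ip z x + ip z y.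
Proof. exact: linearDr. Qed.

Lemma ipNl x z : ip (- x) z = - ip x z.
Proof. exact: linearNl. Qed.

Lemma ipNr x z : ip z (- x) = - ip z x.
Proof. exact: linearNr. Qed.

Lemma ipZl a x z : ip (a *: x) z = a * ip x z.
Proof. by rewrite linearZl_LR. Qed.

Lemma ipZr a x z : ip z (a *: x) = a * ip z x.
Proof. by rewrite ipC ipZl ipC. Qed.

Definition ipE := (ipDl, ipDr, ipNl, ipNr, ipZl, ipZr).

Lemma ip_normE x : ip x x = `|x| ^+ 2.
Proof.
rewrite Hip sqr_sqrtr//.
have [->|x0] := eqVneq x 0; first by rewrite linear0l.
exact/ltW/neq0_dnorm_gt0.
Qed.

Lemma sqr_normD x y : `|x + y| ^+ 2 = `|x| ^+ 2 + 2 * ip x y + `|y| ^+ 2.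
Proof. rewrite -!ip_normE !ipE (ipC y x); ring. Qed.

Lemma ip_CS x y : ip x y <= `|x| * `|y|.
Proof.
have [->|x0] := eqVneq x 0; first by rewrite linear0l normr0 mul0r.
have nx0 : 0 < `|x| by rewrite normr_gt0.
have := sqr_ge0 `|(`|y| *: x - `|x| *: y)|.
rewrite -ip_normE !ipE (ipC y x) !ip_normE => h.
have [->|y0] := eqVneq y 0; first by rewrite linear0r normr0 mulr0.
have ny0 : 0 < `|y| by rewrite normr_gt0.
have xy0 : 0 < `|x| * `|y| by rewrite mulr_gt0.
rewrite -(ler_pM2l xy0); lra.
Qed.

Lemma ip_CS_ge x y : - (`|x| * `|y|) <= ip x y.
Proof. by have := ip_CS (- x) y; rewrite ipNl normrN; lra. Qed.

(** By polarization, the inner product is a combination of squared norms. *)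
Lemma cvg_ip (a b : nat -> H) x y :
  a @ \oo --> x -> b @ \oo --> y -> (fun n => ip (a n) (b n)) @ \oo --> ip x y.
Proof.
move=> ax by_.
have polar u v : ip u v = 2^-1 * (`|u + v| ^+ 2 - `|u| ^+ 2 - `|v| ^+ 2).
  by rewrite sqr_normD; field.
rewrite polar (_ : (fun n => _) =
  fun n => 2^-1 * (`|a n + b n| ^+ 2 - `|a n| ^+ 2 - `|b n| ^+ 2)); last first.
  by apply/funext => n; rewrite polar.
apply: cvgM; first exact: cvg_cst.
apply: cvgB; last exact: cvg_sqr_norm.
by apply: cvgB; apply: cvg_sqr_norm => //; apply: cvgD.
Qed.

End InnerProduct.

Lemma cvg_sqr_dist {R : realType} {H : normedModType R} (a : nat -> H) (l : H)
    (K : R) :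
  (forall n, `|a n - l| ^+ 2 <= K / n.+1%:R) -> a @ \oo --> l.
Proof.
move=> al; apply/cvgrPdist_lt => e e0.
exists (Num.truncn (K / e ^+ 2)) => // n /= Kn.
have K0 : K / e ^+ 2 < n.+1%:R.
  by rewrite (lt_le_trans (truncnS_gt _))// ler_nat.
rewrite distrC -ltr_sqr ?nnegrE ?normr_ge0 ?(ltW e0)//.
apply: le_lt_trans (al n) _.
by rewrite ltr_pdivrMr// mulrC -ltr_pdivrMr// exprn_gt0.
Qed.

(** * Absolute continuity and right derivatives *)

Lemma subr_pair (V : zmodType) (a b c d : V) :
  (a - b) - (c - d) = (a - c) - (b - d).
Proof. by rewrite opprD addrACA -opprD. Qed.

Section AbsoluteContinuity.
Context {R : realType}.

(** Lipschitz functions are dominated by the identity, squared norms of bounded curves by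
the curve itself. *)
Lemma AC_dominated (H H' : normedModType R) (a b K : R) (u : R -> H) (v : R -> H') :
  absolutely_continuous a b u ->
  (forall s t, a <= s -> s <= t -> t <= b ->
     `|v t - v s| <= K * `|u t - u s|) ->
  absolutely_continuous a b v.
Proof.
move=> uAC vu e e0.
have K1 : 0 < `|K| + 1 by rewrite ltr_wpDl.
have [d [d0 ud]] := uAC (e / (`|K| + 1)) ltac:(by rewrite divr_gt0).
exists d; split => // n s t st tI /(ud n s t st tI).
rewrite ltr_pdivlMr// mulrC; apply: le_lt_trans.
rewrite mulr_sumr; apply: ler_sum => i _.
have [as_ st' tb] := st i; apply: le_trans (vu _ _ as_ st' tb) _.
by rewrite ler_wpM2r// (le_trans (ler_norm K))// lerDl.
Qed.

Context {H : normedModType R}.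

Lemma AC_lipschitz (a b K : R) (u : R -> H) :
  (forall s t, a <= s -> s <= t -> t <= b -> `|u t - u s| <= K * (t - s)) ->
  absolutely_continuous a b u.
Proof.
move=> uK.
apply: (@AC_dominated (R : normedModType R) H a b K id u); last first.
  by move=> s t as_ st tb; rewrite [in leRHS]ger0_norm ?subr_ge0//; exact: uK.
move=> e e0; exists e; split => // n s t st _; apply: le_lt_trans.
by apply: ler_sum => i _; have [_ ? _] := st i; rewrite ger0_norm ?subr_ge0.
Qed.

Lemma AC_sub (a b : R) (u v : R -> H) :
  absolutely_continuous a b u -> absolutely_continuous a b v ->
  absolutely_continuous a b (fun t => u t - v t).
Proof.
move=> uAC vAC e e0.
have e2 : 0 < e / 2 by rewrite divr_gt0.
have [d [d0 ud]] := uAC _ e2; have [d' [d'0 vd]] := vAC _ e2.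
exists (Num.min d d'); split; first by rewrite lt_min d0.
move=> n s t st tI; rewrite lt_min => /andP[sd sd'].
have h := ud n s t st tI sd; have h' := vd n s t st tI sd'.
rewrite [ltRHS](splitr e); apply: le_lt_trans (ltrD h h').
rewrite -big_split/=; apply: ler_sum => i _.
by rewrite subr_pair ler_normB.
Qed.

Lemma AC_subitv (a b a' b' : R) (u : R -> H) : a <= a' -> b' <= b ->
  absolutely_continuous a b u -> absolutely_continuous a' b' u.
Proof.
move=> aa' bb' uAC e e0; have [d [d0 ud]] := uAC e e0.
exists d; split => // n s t st; apply: ud => i.
by have [a's ? tb'] := st i; split; [exact: le_trans a's| |exact: le_trans bb'].
Qed.

Lemma AC_sqr_norm (a b B : R) (u : R -> H) :
  absolutely_continuous a b u -> (forall t, a <= t <= b -> `|u t| <= B) ->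
  absolutely_continuous a b (fun t => `|u t| ^+ 2).
Proof.
move=> uAC uB; apply: (AC_dominated (K := 2 * B) uAC) => s t as_ st tb.
have ut : `|u t| <= B by apply: uB; rewrite tb (le_trans as_).
have us : `|u s| <= B by apply: uB; rewrite as_ (le_trans st).
rewrite subr_sqr normrM mulrC ler_pM//.
  by rewrite ger0_norm ?addr_ge0// mulr2n mulrDl mul1r lerD.
exact: ler_dist_dist.
Qed.

End AbsoluteContinuity.

Section RightDerivative.
Context {R : realType} {H : normedModType R} (ip : {dot H for (@idfun R)}).
Hypothesis Hip : norm_from_dot ip.
Implicit Types (u v : R -> H) (p q : H) (t : R).

Definition right_deriv u t q := forall e : R, 0 < e -> exists d : R, 0 < d /\
  forall h : R, 0 < h < d -> `|u (t + h) - u t - h *: q| <= e * h.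

Lemma right_deriv_sub u v t p q : right_deriv u t p -> right_deriv v t q ->
  right_deriv (fun t => u t - v t) t (p - q).
Proof.
move=> up vq e e0.
have e2 : 0 < e / 2 by rewrite divr_gt0.
have [d [d0 ud]] := up _ e2; have [d' [d'0 vd]] := vq _ e2.
exists (Num.min d d'); split; first by rewrite lt_min d0.
move=> h /andP[h0]; rewrite lt_min => /andP[hd hd'].
have hu := ud h ltac:(by rewrite h0); have hv := vd h ltac:(by rewrite h0).
have -> : u (t + h) - v (t + h) - (u t - v t) - h *: (p - q) =
    (u (t + h) - u t - h *: p) - (v (t + h) - v t - h *: q).
  by rewrite scalerBr (subr_pair (u (t + h))) [LHS]subr_pair.
rewrite (le_trans (ler_normB _ _))//; lra.
Qed.

Lemma right_deriv_sqr_norm u t q : right_deriv u t q ->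
  forall e : R, 0 < e -> exists d : R, 0 < d /\ forall h : R, 0 < h < d ->
    `|u (t + h)| ^+ 2 <= `|u t| ^+ 2 + h * (2 * ip (u t) q + e).
Proof.
move=> uq e e0.
pose n := `|u t|; have n0 : 0 <= n by exact: normr_ge0.
pose m := `|q| + 1; have m0 : 0 < m by rewrite ltr_wpDl.
have [d [d0 ud]] := uq (Num.min 1 (e / (4 * (n + 1))))
  ltac:(by rewrite lt_min ltr01 divr_gt0// mulr_gt0// ltr_wpDl).
exists (Num.min d (e / (2 * m ^+ 2))); split.
  by rewrite lt_min d0 divr_gt0// mulr_gt0// exprn_gt0.
move=> h /andP[h0]; rewrite lt_min => /andP[hd].
rewrite ltr_pdivlMr ?mulr_gt0 ?exprn_gt0// => hm.
have := ud h ltac:(by rewrite h0).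
set w := _ - h *: q => wh.
have w1 : `|w| <= h.
  by rewrite (le_trans wh)// ger_pMl// ge_min lexx.
have we : 4 * (n + 1) * `|w| <= e * h.
  have n4 : 0 < 4 * (n + 1) by rewrite mulr_gt0// ltr_wpDl.
  apply: (@le_trans _ _ (4 * (n + 1) * (e / (4 * (n + 1)) * h))).
    rewrite ler_pM2l// (le_trans wh)// ler_pM2r//.
    by rewrite ge_min lexx orbT.
  by rewrite mulrA mulrCA mulfV ?gt_eqF// mulr1.
have -> : u (t + h) = u t + (h *: q + w).
  by rewrite /w !subrKC.
rewrite (sqr_normD Hip) ipDr ipZr.
have : ip (u t) w <= n * `|w| by exact: ip_CS.
have : `|h *: q + w| ^+ 2 <= h * (e / 2).
  apply: (@le_trans _ _ ((h * m) ^+ 2)).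
    rewrite ler_sqr ?nnegrE ?mulr_ge0 ?(ltW h0) ?(ltW m0)//.
    rewrite (le_trans (ler_normD _ _))// normrZ gtr0_norm// /m; lra.
  rewrite exprMn expr2 -mulrA ler_pM2l//; lra.
have := normr_ge0 w.
rewrite -/n; clear -we; lra.
Qed.

(** The form in which the comparison principle is applied to the difference of two
trajectories. *)
Lemma gronwall_sqr_norm u (a b L D B : R) (N : set R) :
  a <= b -> 0 <= L -> 0 <= D -> absolutely_continuous a b u ->
  (forall t, a <= t <= b -> `|u t| <= B) ->
  (@lebesgue_measure R).-negligible N ->
  (forall t, a <= t < b -> ~ N t -> exists q, right_deriv u t q /\
     2 * ip (u t) q <= L * `|u t| ^+ 2 + D) ->
  `|u b| ^+ 2 <= expR (L * (b - a)) * (`|u a| ^+ 2 + D * (b - a)).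
Proof.
move=> ab L0 D0 uAC uB N0 uD.
apply: (gronwall_ae (phi := fun t => `|u t| ^+ 2) ab L0 D0 _ _ N0) => //.
  exact: AC_sqr_norm uB.
move=> t atb Nt e e0.
have [q [uq uqD]] := uD t atb Nt.
have [d [d0 ud]] := right_deriv_sqr_norm uq e0.
exists d; split => // h hd _; apply: le_trans (ud h hd) _.
have /andP[h0 _] := hd.
by rewrite lerD2l ler_pM2l// lerD2r.
Qed.

Lemma derive_epsP u t q : (derivable u t 1 /\ 'D_1 u t = q) <->
  forall e : R, 0 < e -> exists d : R, 0 < d /\
    forall h : R, h != 0 -> `|h| < d -> `|u (t + h) - u t - h *: q| <= e * `|h|.
Proof.
have quot h : h != 0 -> `|h^-1 *: (u (h *: 1 + t) - u t) - q| * `|h| =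
    `|u (t + h) - u t - h *: q|.
  move=> h0; rewrite mulrC -normrZ scalerBr scalerA mulfV// scale1r.
  by rewrite [_ *: 1]mulr1 (addrC h).
split=> [[ut Duq] e e0|uq].
  have /cvgrPdist_le/(_ e e0)[/= d d0 ud] :
    (fun h => h^-1 *: ((u \o shift t) (h *: 1) - u t)) @ 0^' --> q by rewrite -Duq.
  exists d; split => // h h0 hd; rewrite -quot// ler_wpM2r//.
  rewrite distrC; apply: ud => //.
  by rewrite /= sub0r normrN.
have ql : (fun h => h^-1 *: ((u \o shift t) (h *: 1) - u t)) @ 0^' --> q.
  apply/cvgrPdist_le => e e0.
  have [d [d0 ud]] := uq e e0.
  exists d => // h; rewrite /= sub0r normrN => hd h0.
  rewrite distrC -(@ler_pM2r _ `|h|) ?normr_gt0// quot//.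
  exact: ud.
split; last exact: cvg_lim ql.
by apply/cvg_ex; exists q.
Qed.
End RightDerivative.

(** The case [L = 0] of the comparison principle, where neither the function nor its slope
[D] needs a sign: subtract the affine function of slope [D]. *)
Lemma dini_le {R : realType} (phi : R -> R) (a b D : R) : a <= b ->
  absolutely_continuous a b phi ->
  (forall t, a <= t < b -> forall e : R, 0 < e -> exists d : R, 0 < d /\
    forall h : R, 0 < h < d -> t + h <= b -> phi (t + h) <= phi t + h * (D + e)) ->
  phi b <= phi a + D * (b - a).
Proof.
move=> ab phiAC phiD.
have linAC : absolutely_continuous a b (fun t : R => phi a + D * (t - a)).
  apply: (AC_lipschitz (K := `|D|)) => s t _ st _.
  rewrite (_ : _ - _ = D * (t - s)); last by ring.
  by rewrite normrM (ger0_norm (_ : 0 <= t - s)) ?subr_ge0.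
have := gronwall_ae (phi := fun t => phi t - (phi a + D * (t - a))) ab
  (lexx 0) (lexx 0) (lexx 0) (AC_sub phiAC linAC)
  (negligible_set0 (@lebesgue_measure R)).
move=> /(_ _ _)/wrap[].
- move=> t tab _ e e0; have [d [d0 phid]] := phiD t tab e e0.
  exists d; split => // h hd thb; have := phid h hd thb; lra.
- lra.
rewrite mul0r expR0; lra.
Qed.

(** * Normals of directionally prox-regular sets *)

Section ProxNormal.
Context {R : realType} {H : normedModType R} (ip : {dot H for (@idfun R)}).
Hypothesis Hip : norm_from_dot ip.
Variables (r : R) (C : set H) (f : H -> H).
Hypotheses (r_gt0 : 0 < r) (C_closed : closed C).
Implicit Types (c v x y z q : H) (s k e M L : R).

(** The normals that obey the quadratic inequality with the constant of [C] itself: when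
[v] is a nonzero vector this says that [v / |v|] belongs to [Gamma r C c].  The norm
of [v] is kept in the inequality so that it passes to the limit, [v = 0] included. *)
Definition hyponormal c v := C c /\
  forall y, C y -> 2 * r * ip v (y - c) <= `|v| * `|y - c| ^+ 2.

Lemma dist_to_le x y : C y -> dist_to C x <= `|x - y|.
Proof.
move=> Cy; apply: ge_inf; last by exists y.
by exists 0 => _ [z _ <-].
Qed.

Lemma projP x z : Defs.proj C x z <-> C z /\ forall y, C y -> `|x - z| <= `|x - y|.
Proof.
split=> [[Cz xz]|[Cz xz]]; split => //.
  by move=> y Cy; rewrite xz dist_to_le.
apply/eqP; rewrite eq_le dist_to_le// andbT.
apply: lb_le_inf; first by exists `|x - z|, z.
by move=> _ [y Cy <-]; exact: xz.
Qed.

(** Expanding the squared distance of [x + s v] to [y] turns minimality of [x] into a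
quadratic inequality on [C]. *)
Lemma proj_shiftP x v s :
  Defs.proj C (x + s *: v) x <->
  C x /\ forall y, C y -> 2 * s * ip v (y - x) <= `|y - x| ^+ 2.
Proof.
rewrite projP.
have E y : `|x + s *: v - y| ^+ 2 =
    `|s *: v| ^+ 2 - 2 * s * ip v (y - x) + `|y - x| ^+ 2.
  rewrite (_ : x + s *: v - y = s *: v + - (y - x)).
    rewrite (sqr_normD Hip (s *: v)) normrN ipNr ipZl; ring.
  by rewrite opprB addrCA addrA.
have E0 : x + s *: v - x = s *: v by rewrite addrC addKr.
have sqE y : (`|x + s *: v - x| <= `|x + s *: v - y|) =
    (2 * s * ip v (y - x) <= `|y - x| ^+ 2).
  rewrite -[LHS]ler_sqr ?nnegrE ?normr_ge0// (E y) E0.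
  by rewrite -addrA lerDl addrC subr_ge0.
by split=> -[Cx xs]; split=> // y Cy; have := xs y Cy; rewrite sqE.
Qed.

Lemma hyponormal_proximal c v : hyponormal c v -> proximal_normal C c v.
Proof.
move=> [Cc cv].
have v1 : 0 < `|v| + 1 by rewrite ltr_wpDl.
pose s := r / (`|v| + 1).
have s0 : 0 < s by rewrite divr_gt0.
have sv : s * (`|v| + 1) = r by rewrite /s divfK// gt_eqF.
exists s; split => //; apply/proj_shiftP; split => // y Cy.
rewrite -(ler_pM2l r_gt0).
have := sqr_ge0 `|y - c|; have := cv y Cy.
set n2 := `|y - c| ^+ 2; set i := ip v _ => h n20.
have := ler_wpM2l (ltW s0) h.
have : 0 <= s * n2 by rewrite mulr_ge0// ltW.
rewrite -{3}sv; lra.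
Qed.

Lemma proximal_normalP x v : proximal_normal C x v ->
  C x /\ exists s : R, 0 < s /\ forall y, C y -> 2 * s * ip v (y - x) <= `|y - x| ^+ 2.
Proof. by move=> [s [s0 /proj_shiftP[Cx xs]]]; split => //; exists s. Qed.

(** One step of the catching-up algorithm.  The prox-regularity hypothesis is used at
parameter [s = h |f x|], which turns the unit direction back into [h f x]; a zero of
[f] gives the trivial step. *)
Lemma prox_step x (h : R) : prox_regular r f C -> C x -> 0 < h -> h * `|f x| < r ->
  exists z, hyponormal z (h^-1 *: (x + h *: f x - z)) /\
    forall c, C c -> `|x + h *: f x - z| <= `|x + h *: f x - c|.
Proof.
move=> Cprox Cx h0 hfr.
have [fx0|fx0] := eqVneq (f x) 0.
  exists x; rewrite fx0 scaler0 addr0 subrr scaler0; split.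
    by split=> // y Cy; rewrite (linear0l (ip : {bilinear H -> H -> R | _ & _})) normr0 mulr0 mul0r.
  by move=> c _; rewrite normr0.
have nf0 : 0 < `|f x| by rewrite normr_gt0.
have [|z] := Cprox x Cx (h * `|f x|).
  by rewrite hfr mulr_gt0.
rewrite /normalize scalerA mulfK ?gt_eqF//.
set y := x + h *: f x.
move=> [projz zG]; exists z.
have /projP[Cz zmin] : Defs.proj C y z by rewrite projz.
split=> //; split => // c Cc.
move: zG => /proj_shiftP[_ /(_ _ Cc)].
rewrite !ipZl normrZ normfV (gtr0_norm h0).
have [->|yz] := eqVneq (y - z) 0.
  by rewrite (linear0l (ip : {bilinear H -> H -> R | _ & _})) normr0 !mulr0 mul0r.
have nyz : 0 < `|y - z| by rewrite normr_gt0.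
set i := ip _ _; set n := _ ^+ 2 => hi.
have : 2 * r * i <= `|y - z| * n.
  rewrite -(ler_pM2l (_ : 0 < `|y - z|^-1)) ?invr_gt0//.
  by rewrite mulKf ?gt_eqF//; lra.
have hV : 0 < h^-1 by rewrite invr_gt0.
by rewrite -(ler_pM2l hV); lra.
Qed.

(** The two quadratic inequalities add up to hypomonotonicity of the normals. *)
Lemma hyponormal_opposite M c v c' v' :
  hyponormal c v -> hyponormal c' v' -> `|v| <= M -> `|v'| <= M ->
  - (M / r * `|c - c'| ^+ 2) <= ip (v - v') (c - c').
Proof.
move=> [Cc cv] [Cc' cv'] vM vM'.
have := cv c' Cc'; have := cv' c Cc.
rewrite (distrC c' c); set n := `|c - c'| ^+ 2.
have n0 : 0 <= n by rewrite sqr_ge0.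
have : `|v| * n <= M * n by rewrite ler_wpM2r.
have : `|v'| * n <= M * n by rewrite ler_wpM2r.
rewrite -(opprB c c') !ipE => h1 h2 h3 h4.
rewrite -(ler_pM2l r_gt0).
have -> : r * - (M / r * n) = - (M * n) by field; rewrite gt_eqF.
lra.
Qed.

Lemma one_sided_lipschitz L M c v c' v' : (forall x y, `|f x - f y| <= L * `|x - y|) ->
  hyponormal c v -> hyponormal c' v' -> `|v| <= M -> `|v'| <= M ->
  ip ((f c - v) - (f c' - v')) (c - c') <= (L + M / r) * `|c - c'| ^+ 2.
Proof.
move=> fL cv cv' vM vM'.
have := hyponormal_opposite cv cv' vM vM'.
have : ip (f c - f c') (c - c') <= L * `|c - c'| ^+ 2.
  apply: le_trans (ip_CS Hip _ _) _.
  by rewrite expr2 mulrA ler_wpM2r.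
rewrite !ipE; lra.
Qed.

Lemma hyponormal_closed (c v : nat -> H) (c0 v0 : H) :
  (forall n, hyponormal (c n) (v n)) -> c @ \oo --> c0 -> v @ \oo --> v0 ->
  hyponormal c0 v0.
Proof.
move=> cv cc vv; split.
  by apply: (closed_cvg C) cc => //; apply: nearW => n; have [] := cv n.
move=> y Cy.
have yc : (fun n => y - c n) @ \oo --> y - c0 by apply: cvgB => //; exact: cvg_cst.
have l : (fun n => 2 * r * ip (v n) (y - c n)) @ \oo --> 2 * r * ip v0 (y - c0).
  by apply: cvgM; [exact: cvg_cst | exact: cvg_ip].
have l' : (fun n => `|v n| * `|y - c n| ^+ 2) @ \oo --> `|v0| * `|y - c0| ^+ 2.
  by apply: cvgM; [exact: cvg_norm|exact: cvg_sqr_norm].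
apply: ler_cvg_to l l' _; apply: nearW => n.
by have [_] := cv n; apply.
Qed.

(** Bouligand tangency of [q] to [C] at [x].  Only the tangent vectors to trajectories
matter, so a formulation by arbitrarily small steps [k] is enough. *)
Definition contingent x q := forall e : R, 0 < e -> exists k : R,
  0 < k < e /\ exists c, C c /\ `|c - (x + k *: q)| <= e * k.

Lemma contingent_normal_ge0 x v q : proximal_normal C x v ->
  contingent x (- q) -> 0 <= ip v q.
Proof.
move=> /proximal_normalP[Cx [s [s0 xs]]] xq.
rewrite -oppr_le0; apply/ler_addgt0Pr => e e0; rewrite add0r.
pose B := 2 * s * `|v| + (`|q| + 1) ^+ 2.
have B0 : 0 < B + 1.
  by rewrite ltr_wpDl// addr_ge0 ?sqr_ge0// !mulr_ge0// ltW.
pose eta := Num.min 1 (2 * s * e / (B + 1)).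
have eta0 : 0 < eta by rewrite lt_min ltr01 divr_gt0// !mulr_gt0.
have eta1 : eta <= 1 by rewrite ge_min lexx.
have etae : eta * (B + 1) <= 2 * s * e by rewrite -ler_pdivlMr// ge_min lexx orbT.
have [k [/andP[k0 ke] [c [Cc ck]]]] := xq eta eta0.
set d := c - _ in ck.
have cx : c - x = d - k *: q by rewrite /d scalerN opprD opprK addrA addrK.
clearbody d.
have nd : `|c - x| <= k * (`|q| + 1).
  rewrite cx (le_trans (ler_normB _ _))// normrZ gtr0_norm//.
  have : eta * k <= 1 * k by rewrite ler_wpM2r// ltW.
  lra.
have nd2 : `|c - x| ^+ 2 <= k * (eta * (`|q| + 1) ^+ 2).
  apply: (@le_trans _ _ ((k * (`|q| + 1)) ^+ 2)).
    by rewrite ler_sqr ?nnegrE// mulr_ge0 ?addr_ge0// ltW.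
  rewrite exprMn expr2 -mulrA ler_pM2l// ler_wpM2r ?sqr_ge0//; lra.
have vd : - (`|v| * (eta * k)) <= ip v d.
  apply: le_trans (ip_CS_ge Hip v d).
  by rewrite lerN2 ler_wpM2l.
have := xs c Cc; rewrite cx !ipE -cx => h.
have : k * (2 * s * - ip v q) <= k * (2 * s * e).
  apply: (@le_trans _ _ (k * (eta * (B + 1)))); last by rewrite ler_pM2l.
  have : 2 * s * - (`|v| * (eta * k)) <= 2 * s * ip v d.
    by rewrite ler_pM2l ?mulr_gt0.
  have : 0 <= k * eta by rewrite mulr_ge0 ?ltW.
  rewrite /B; lra.
by rewrite ler_pM2l// ler_pM2l// mulr_gt0.
Qed.

(** The normal component [v = f x - q] is a limit of residuals of projections.  Let
[z = x + k zeta] be the projection of [x + k f x] on [C].  A point of [C] near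
[x + k q] competes with [z], hence [|f x - zeta| <= |v| + o(1)].  Since
[f x - zeta = v - (zeta - q)], this reads
[|zeta - q|^2 <= 2 <v, zeta> - 2 <v, q> + o(1)]; the first product is [O(k)] because
[v] is a proximal normal, and [<v, q> >= 0] because [- q] is tangent.  So [zeta] tends
to [q], and the uniform inequality for the residuals passes to the limit. *)
Lemma velocity_hyponormal x q :
  prox_regular r f C -> C x -> contingent x q -> contingent x (- q) ->
  proximal_normal C x (f x - q) ->
  hyponormal x (f x - q) /\ `|f x - q| <= `|f x|.
Proof.
move=> Cprox Cx xq xqN vN.
set v := f x - q in vN *.
have fE : f x = v + q by rewrite subrK.
have vE : v = f x - q by [].
clearbody v.
have vq0 := contingent_normal_ge0 vN xqN.
split; last first.
  rewrite -ler_sqr ?nnegrE// fE (sqr_normD Hip).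
  by have := sqr_ge0 `|q|; lra.
have [_ [s [s0 xs]]] := proximal_normalP vN.
pose F := `|f x|.
have F0 : 0 <= F by exact: normr_ge0.
have F1 : 0 < F + 1 by rewrite ltr_wpDl.
pose K := 2 * `|v| + 1 + 4 * F ^+ 2 / s.
have K0 : 0 <= K.
  have := normr_ge0 v.
  have : 0 <= 4 * F ^+ 2 / s by rewrite divr_ge0 ?(ltW s0)// mulr_ge0// sqr_ge0.
  rewrite /K; lra.
have step n : exists kz : R * H, [/\ 0 < kz.1, kz.1 <= n.+1%:R^-1,
   hyponormal kz.2 (kz.1^-1 *: (x + kz.1 *: f x - kz.2)),
   `|kz.2 - x| <= kz.1 * (2 * F) &
   `|kz.1^-1 *: (kz.2 - x) - q| ^+ 2 <= K / n.+1%:R].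
  pose eta := Num.min n.+1%:R^-1 (r / (F + 1)).
  have eta0 : 0 < eta by rewrite lt_min invr_gt0 ltr0Sn divr_gt0.
  have etan : eta <= n.+1%:R^-1 by rewrite ge_min lexx.
  have etar : eta * (F + 1) <= r by rewrite -ler_pdivlMr// ge_min lexx orbT.
  have [k [/andP[k0 ke] [c [Cc ck]]]] := xq eta eta0.
  have kF : k * F < r.
    apply: lt_le_trans etar.
    have : k * F <= eta * F by rewrite ler_wpM2r// ltW.
    lra.
  have [z [zN zmin]] := prox_step Cprox Cx k0 kF.
  exists (k, z) => /=.
  set zeta := k^-1 *: (z - x).
  have zE : z - x = k *: zeta by rewrite /zeta scalerA mulfV ?scale1r// gt_eqF.
  have yz : x + k *: f x - z = k *: (f x - zeta).
    by rewrite scalerBr -zE opprB addrCA addrA.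
  have fz : `|f x - zeta| <= F.
    have := zmin x Cx; rewrite yz addrAC subrr add0r !normrZ gtr0_norm//.
    by rewrite ler_pM2l.
  have nzeta : `|zeta| <= 2 * F.
    have -> : zeta = f x - (f x - zeta) by rewrite opprB addrCA subrr addr0.
    by rewrite (le_trans (ler_normB _ _))// -/F; lra.
  split => //.
  - by rewrite (le_trans (ltW ke)).
  - by rewrite zE normrZ gtr0_norm// ler_pM2l.
  (* The point [c] of [C], close to [x + k q], competes with [z]. *)
  have fz2 : `|f x - zeta| <= `|v| + eta.
    have := zmin c Cc; rewrite yz normrZ gtr0_norm// => h.
    rewrite -(ler_pM2l k0); apply: le_trans h _.
    have -> : x + k *: f x - c = k *: v - (c - (x + k *: q)).
      by rewrite fE scalerDr opprB addrCA -addrA.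
    rewrite (le_trans (ler_normB _ _))// normrZ gtr0_norm//; lra.
  have vz : ip v zeta <= 4 * F ^+ 2 * eta / s * 2^-1.
    have Cz : C z by have [] := zN.
    have := xs z Cz; rewrite zE ipZr normrZ gtr0_norm// exprMn => h.
    have : k * (2 * s * ip v zeta) <= k * (eta * (2 * F) ^+ 2).
      have : (k * `|zeta|) ^+ 2 <= k * (eta * (2 * F) ^+ 2).
        rewrite exprMn expr2 -mulrA ler_pM2l//.
        by rewrite ler_pM ?sqr_ge0// ?(ltW k0) ?(ltW ke)// ler_sqr ?nnegrE// mulr_ge0.
      rewrite exprMn; lra.
    rewrite ler_pM2l// => h'.
    rewrite -(@ler_pM2l _ (2 * s)) ?mulr_gt0//.
    apply: (le_trans h'); rewrite exprMn le_eqVlt; apply/orP; left.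
    by apply/eqP; field; rewrite gt_eqF.
  have eta1 : eta <= 1.
    by rewrite (le_trans etan)// invf_le1 ?ltr0Sn// ler1n.
  have : `|f x - zeta| ^+ 2 <= (`|v| + eta) ^+ 2.
    by rewrite ler_sqr ?nnegrE// addr_ge0// ltW.
  have -> : f x - zeta = v - (zeta - q) by rewrite fE opprB addrA.
  rewrite (sqr_normD Hip) normrN ipNr ipDr ipNr => h.
  apply: (@le_trans _ _ (K * eta)); last first.
    by rewrite ler_wpM2l.
  have : eta ^+ 2 <= eta by rewrite expr2 ger_pMl.
  rewrite /K; lra.
have [kz kzP] := choice step.
apply: (@hyponormal_closed (fun n => (kz n).2)
  (fun n => (kz n).1^-1 *: (x + (kz n).1 *: f x - (kz n).2))).
- by move=> n; have [] := kzP n.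
- apply: (@cvg_sqr_dist _ _ _ _ ((2 * F) ^+ 2)) => n.
  have [k0 kn _ zx _] := kzP n.
  apply: (@le_trans _ _ (((kz n).1 * (2 * F)) ^+ 2)).
    rewrite ler_sqr ?nnegrE ?normr_ge0//.
    by rewrite !mulr_ge0// ltW.
  rewrite exprMn mulrC ler_wpM2l ?sqr_ge0//.
  have n1 : n.+1%:R^-1 <= 1 :> R by rewrite invf_le1 ?ltr0Sn// ler1n.
  by rewrite expr2 (le_trans _ kn)// ger_pMl// (le_trans kn).
- apply: (@cvg_sqr_dist _ _ _ _ K) => n.
  have [k0 _ _ _] := kzP n; congr (_ ^+ 2 <= _).
  rewrite vE -normrN; congr (`| _ |).
  have -> : (kz n).1^-1 *: (x + (kz n).1 *: f x - (kz n).2) =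
      f x - (kz n).1^-1 *: ((kz n).2 - x).
    rewrite (_ : x + _ - _ = (kz n).1 *: f x - ((kz n).2 - x)).
      by rewrite scalerBr scalerA mulVf ?scale1r// gt_eqF.
    by rewrite opprB addrCA addrA.
  by rewrite !opprB [RHS]addrC addrA subrK.
Qed.

End ProxNormal.

(** * Velocities of solutions and uniqueness *)

Section SolutionUniqueness.
Context {R : realType} {H : normedModType R} (ip : {dot H for (@idfun R)}).
Hypothesis Hip : norm_from_dot ip.
Variables (r : R) (C : set H) (f : H -> H) (T : R).
Hypotheses (r_gt0 : 0 < r) (C_closed : closed C) (T_gt0 : 0 < T).
Hypothesis C_prox : prox_regular r f C.
Implicit Types (x q : H) (w u : R -> H) (t : R).
Notation mu := (@lebesgue_measure R).

(** A proximal normal exists only at points of [C], so a solution lies in [C] almost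
everywhere; by continuity it cannot leave the closed set [C] on an interval. *)
Lemma solution_in_C (u0 : H) w t :
  is_solution T f C u0 w -> 0 <= t <= T -> C (w t).
Proof.
move=> [wAC [N [mN N0 NN]] _] /andP[t0 tT].
apply: contrapT => nC.
have : nbhs (w t) (~` C) by apply: open_nbhs_nbhs; split => //; exact: closed_openC.
move=> /nbhs_ballP[e /= e0 eC].
have [d [d0 wd]] := AC_continuous wAC e0.
pose p := Num.max 0 (t - d / 2); pose q := Num.min T (t + d / 2).
have p0 : 0 <= p by rewrite le_max lexx.
have pt : t - d / 2 <= p by rewrite le_max lexx orbT.
have qT : q <= T by rewrite ge_min lexx.
have qt : q <= t + d / 2 by rewrite ge_min lexx orbT.
have pq : p < q.
  by rewrite gt_max !lt_min T_gt0/=; apply/andP; split; [lra|apply/andP; split; lra].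
have pqN : `[p, q] `<=` N.
  move=> s /=; rewrite in_itv/= => /andP[ps sq]; apply: NN => /=.
  move=> /(_ ltac:(by rewrite in_itv/=; apply/andP; split; lra)).
  move=> [_ [v [k [_ []]]]] + _ _; apply: eC.
  rewrite -ball_normE/=; have [ts|st] := leP t s.
    by rewrite distrC; apply: wd; lra.
  by apply: wd; lra.
have : (mu `[p, q]%classic <= mu N)%E.
  by apply: le_measure; rewrite ?inE //; exact: measurable_itv.
rewrite lebesgue_measure_itv/= lte_fin pq [X in (_ <= X)%E](N0 : mu N = 0%E).
by rewrite -EFinB lee_fin leNgt subr_gt0 pq.
Qed.

Lemma solution_velocity (u0 : H) w : is_solution T f C u0 w ->
  exists N : set R, mu.-negligible N /\ forall t, 0 <= t < T -> ~ N t ->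
    exists q, [/\ right_deriv w t q,
      hyponormal ip r C (w t) (f (w t) - q) & `|f (w t) - q| <= `|f (w t)| ].
Proof.
move=> wsol; have wC := solution_in_C wsol.
move: wsol => [_ waeP _].
exists (~` [set t | `[0, T]%classic t -> derivable w t 1 /\
         [set 'D_1 w t + v | v in proximal_normal C (w t)] (f (w t))] `|` [set 0]).
split.
  apply: negligibleU; first exact: waeP.
  by exists [set 0]; split => //; exact: lebesgue_measure_set1.
move=> t /andP[t0 tT] /not_orP[/contrapT /= tP /eqP t_neq0].
have {}t0 : 0 < t by rewrite lt_neqAle eq_sym t_neq0.
have [wt [v vN vE]] := tP ltac:(by rewrite in_itv/= !ltW).
pose q := 'D_1 w t.
have wq : derivable w t 1 /\ 'D_1 w t = q by [].
move: wq => /derive_epsP wq.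
have fq : f (w t) - q = v by rewrite -vE /q addrC addKr.
have right : right_deriv w t q.
  move=> e e0; have [d [d0 wd]] := wq e e0; exists d; split => // h /andP[h0 hd].
  by have := wd h; rewrite gtr0_norm// gt_eqF//; exact.
have near_cont e : 0 < e -> exists k : R, [/\ 0 < k, k < e, t + k <= T, 0 <= t - k &
    `|w (t + k) - w t - k *: q| <= e * k /\ `|w (t - k) - w t + k *: q| <= e * k].
  move=> e0; have [d [d0 wd]] := wq e e0.
  pose k := Num.min (Num.min d e) (Num.min t (T - t)) / 2.
  have m0 : 0 < Num.min (Num.min d e) (Num.min t (T - t)).
    by rewrite !lt_min d0 e0 t0 subr_gt0.
  have k0 : 0 < k by rewrite divr_gt0.
  have km : k + k <= Num.min (Num.min d e) (Num.min t (T - t)).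
    by rewrite -splitr.
  move: km; rewrite !le_min => /andP[/andP[kd ke] /andP[kt kT]].
  exists k; split; [by []|lra|lra|lra|split].
    by have := wd k; rewrite gtr0_norm// gt_eqF//; apply => //; lra.
  have := wd (- k); rewrite normrN gtr0_norm// oppr_eq0 gt_eqF// scaleNr opprK.
  by apply => //; lra.
have wtC : C (w t) by apply: wC; rewrite !ltW.
have cont : contingent C (w t) q.
  move=> e /near_cont[k [k0 ke kT kt [wk _]]]; exists k; split; first by rewrite k0.
  exists (w (t + k)); split; first by apply: wC; rewrite kT andbT; lra.
  by rewrite opprD addrA.
have contN : contingent C (w t) (- q).
  move=> e /near_cont[k [k0 ke kT kt [_ wk]]]; exists k; split; first by rewrite k0.
  exists (w (t - k)); split; first by apply: wC; rewrite kt /=; lra.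
  by rewrite scalerN opprB addrCA addrC.
have vN' : proximal_normal C (w t) (f (w t) - q) by rewrite fq.
by exists q; have [] := velocity_hyponormal Hip r_gt0 C_closed C_prox wtC cont contN vN'.
Qed.

Variables (L K : R).
Hypotheses (L_ge0 : 0 <= L) (K_ge0 : 0 <= K).
Hypothesis f_growth : forall x, `|f x| <= L * (1 + `|x|).
Hypothesis f_lip : forall x y, `|f x - f y| <= K * `|x - y|.

(** The velocity is dominated by [2 |f(w)|], which grows at most linearly. *)
Lemma solution_bounded (u0 : H) w : is_solution T f C u0 w ->
  exists B : R, forall t, 0 <= t <= T -> `|w t| <= B.
Proof.
move=> wsol; have [N [N0 wN]] := solution_velocity wsol.
have [wAC _ _] := wsol.
exists (expR (2 * L * T) * (`|w 0| + 2 * L * T)) => t /andP[t0 tT].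
have L2 : 0 <= 2 * L by rewrite mulr_ge0.
apply: (@le_trans _ _ (expR (2 * L * (t - 0)) * (`|w 0| + 2 * L * (t - 0)))).
  apply: (gronwall_ae (phi := fun t => `|w t|) t0 L2 L2 _ _ N0) => //.
    apply: (AC_dominated (u := w) (K := 1)); first exact: AC_subitv wAC.
    by move=> *; rewrite mul1r; exact: ler_dist_dist.
  move=> s /andP[s0 st] /wN[|q [wq _ fq] e e0].
    by rewrite s0 (lt_le_trans st).
  have [d [d0 wd]] := wq e e0; exists d; split => // h hd _.
  have := wd h hd; have /andP[h0 _] := hd.
  set z := w (s + h) - w s - h *: q => zh.
  have -> : w (s + h) = w s + (h *: q + z) by rewrite /z !subrKC.
  have : `|q| <= 2 * (L * (1 + `|w s|)).
    have -> : q = f (w s) - (f (w s) - q) by rewrite opprB subrKC.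
    by rewrite (le_trans (ler_normB _ _))//; have := f_growth (w s); lra.
  rewrite -(ler_pM2l h0) => hq.
  have := ler_normD (w s) (h *: q + z); have := ler_normD (h *: q) z.
  rewrite normrZ gtr0_norm//; lra.
rewrite subr0 ler_pM ?expR_ge0 ?addr_ge0 ?mulr_ge0//.
  by rewrite ler_expR ler_wpM2l.
by rewrite lerD2l ler_wpM2l.
Qed.

Lemma solution_unique (u0 : H) w u : is_solution T f C u0 w ->
  is_solution T f C u0 u -> forall t, 0 <= t <= T -> w t = u t.
Proof.
move=> wsol usol t /andP[t0 tT].
have [N [N0 wN]] := solution_velocity wsol.
have [N' [N'0 uN]] := solution_velocity usol.
have [B wB] := solution_bounded wsol; have [B' uB] := solution_bounded usol.
have [wAC _ w0] := wsol; have [uAC _ u0E] := usol.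
pose M := L * (1 + Num.max B B').
have fM s x : 0 <= s <= T -> `|x| <= Num.max B B' -> `|f x| <= M.
  by move=> sT xB; rewrite (le_trans (f_growth _))// ler_wpM2l// lerD2l.
have M0 : 0 <= M.
  apply: le_trans (fM 0 (w 0) _ _) => //; first by rewrite lexx ltW.
  by rewrite le_max wB// lexx ltW.
have KM : 0 <= 2 * (K + M / r) by rewrite mulr_ge0// addr_ge0// divr_ge0// ltW.
have := gronwall_sqr_norm Hip t0 KM (lexx 0)
  (AC_subitv (lexx 0) tT (AC_sub wAC uAC))
  (B := B + B') _ (negligibleU N0 N'0).
rewrite w0 u0E subrr normr0 expr0n mul0r addr0 mulr0 => /(_ _ _)/wrap[].
- move=> s /andP[s0 st]; rewrite (le_trans (ler_normB _ _))// lerD ?wB ?uB//; 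
    by rewrite s0 (le_trans st).
- move=> s /andP[s0 st] /not_orP[/wN[|p [wp pN pf]]].
    by rewrite s0 (lt_le_trans st).
  move=> /uN[|q [uq qN qf]]; first by rewrite s0 (lt_le_trans st).
  exists (p - q); split; first exact: right_deriv_sub.
  have sT : 0 <= s <= T by rewrite s0 (le_trans (ltW st)).
  have pM : `|f (w s) - p| <= M.
    by rewrite (le_trans pf)// (fM s)// le_max wB.
  have qM : `|f (u s) - q| <= M.
    by rewrite (le_trans qf)// (fM s)// le_max uB// orbT.
  have := one_sided_lipschitz Hip r_gt0 f_lip pN qN pM qM.
  rewrite !subKr (ipC ip (p - q)) addr0; lra.
by rewrite le_eqVlt ltNge sqr_ge0 orbF sqrf_eq0 normr_eq0 subr_eq0 => /eqP.
Qed.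

End SolutionUniqueness.

(** * The projected velocity field *)

Lemma cvg_cauchy_seq {R : realType} {H : completeNormedModType R} (a : nat -> H) :
  (forall e : R, 0 < e -> exists N, forall n, (N <= n)%N -> `|a n - a N| <= e) ->
  cvg (a @ \oo).
Proof.
move=> aC; apply: cauchy_cvg; apply: cauchy_exP => e e0.
have [N aN] := aC (e / 2) ltac:(by rewrite divr_gt0).
exists (a N), N => // n /= Nn; rewrite -ball_normE/= distrC.
by rewrite (le_lt_trans (aN n Nn))// ltr_pdivrMr// ltr_pMr// ltr1n.
Qed.

Section ProjectedVelocity.
Context {R : realType} {H : completeNormedModType R} (ip : {dot H for (@idfun R)}).
Hypothesis Hip : norm_from_dot ip.
Variables (r : R) (C : set H) (f : H -> H).
Hypotheses (r_gt0 : 0 < r) (C_closed : closed C).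
Hypothesis C_prox : prox_regular r f C.
Implicit Types (x a b g : H) (s t h M : R).

(** What is retained of the fact that [x + h a] is the projection of [x + h f x] on [C]:
[a] is the effective velocity of the step and [f x - a] its normal part. *)
Definition catching_step x h a :=
  hyponormal ip r C (x + h *: a) (f x - a) /\ `|f x - a| <= `|f x|.

Lemma catching_step_exists x h : C x -> 0 < h -> h * `|f x| < r ->
  exists a, catching_step x h a.
Proof.
move=> Cx h0 hr; have [z [zN zmin]] := prox_step Hip C_prox Cx h0 hr.
exists (h^-1 *: (z - x)).
have zE : x + h *: (h^-1 *: (z - x)) = z.
  by rewrite scalerA mulfV ?gt_eqF// scale1r subrKC.
have vE : f x - h^-1 *: (z - x) = h^-1 *: (x + h *: f x - z).
  rewrite (_ : x + _ - _ = h *: f x - (z - x)).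
    by rewrite [RHS]scalerBr scalerA mulVf ?scale1r// gt_eqF.
  by rewrite opprB addrCA addrA.
split; first by rewrite zE vE.
have := zmin x Cx; rewrite (addrAC x _ (- x)) subrr add0r [leRHS]normrZ gtr0_norm// => h1.
by rewrite vE normrZ gtr0_norm ?invr_gt0// mulrC ler_pdivrMr// mulrC.
Qed.

Lemma catching_step_norm x h a M : catching_step x h a -> `|f x| <= M ->
  `|a| <= 2 * M.
Proof.
move=> [_ fa] fM; have -> : a = f x - (f x - a) by rewrite subKr.
by rewrite (le_trans (ler_normB _ _))//; lra.
Qed.

(** The resolvent identity
[2 <a - b, s a - t b> = (s + t) |a - b|^2 + (s - t) (|a|^2 - |b|^2)]
combined with hypomonotonicity of the normal parts.  For a monotone normal cone the
last term would be absent and [|a|] would increase as the step decreases. *)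
Lemma catching_step_compare x s t a b M : C x -> `|f x| <= M -> 0 < t -> t <= s ->
  catching_step x s a -> catching_step x t b ->
  (s + t) * `|a - b| ^+ 2 <=
    (s - t) * (`|b| ^+ 2 - `|a| ^+ 2) + 32 * M ^+ 3 / r * s ^+ 2.
Proof.
move=> Cx fM t0 ts sa tb.
have aM := catching_step_norm sa fM; have bM := catching_step_norm tb fM.
move: sa tb => [aN fa] [bN fb].
have s0 : 0 < s by exact: lt_le_trans ts.
have := hyponormal_opposite r_gt0 aN bN (le_trans fa fM) (le_trans fb fM).
have -> : f x - a - (f x - b) = - (a - b) by rewrite subr_pair subrr sub0r.
have -> : x + s *: a - (x + t *: b) = s *: a - t *: b.
  by rewrite opprD addrACA subrr add0r.
have nab : `|s *: a - t *: b| <= s * (4 * M).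
  rewrite (le_trans (ler_normB _ _))// !normrZ !gtr0_norm//.
  have : s * `|a| <= s * (2 * M) by rewrite ler_pM2l.
  have : t * `|b| <= s * (2 * M) by rewrite ler_pM// ltW.
  lra.
have M0 : 0 <= M by rewrite (le_trans _ fM).
have : M / r * `|s *: a - t *: b| ^+ 2 <= M / r * (s * (4 * M)) ^+ 2.
  rewrite ler_wpM2l ?divr_ge0 ?(ltW r_gt0)// ler_sqr ?nnegrE//.
  by rewrite (le_trans _ nab).
have -> : M / r * (s * (4 * M)) ^+ 2 = 16 * M ^+ 3 / r * s ^+ 2 by ring.
rewrite (sqr_normD Hip a) normrN !(ipE ip) !(ip_normE Hip) (ipC ip b a).
set n := _ * `|_ - _| ^+ 2; set m := _ / r.
have -> : 32 * M ^+ 3 / r = 2 * m by rewrite /m; ring.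
clearbody n m; lra.
Qed.

(** The limit, along some steps tending to 0, of the effective velocities of the catching-up
steps issued from [x]. *)
Definition projected_velocity x g :=
  [/\ hyponormal ip r C x (f x - g), `|f x - g| <= `|f x| &
    forall e : R, 0 < e -> exists s a,
      [/\ 0 < s, s < e, catching_step x s a & `|a - g| <= e] ].

(** Along the steps [s n = s0 / 2 ^ n] the numbers [|a n|^2 - 4 A s n] are nondecreasing
and bounded, hence convergent; by [catching_step_compare] the velocities [a n]
then form a Cauchy sequence. *)
Lemma projected_velocity_exists x : C x -> exists g, projected_velocity x g.
Proof.
move=> Cx; pose M := `|f x|.
have M0 : 0 <= M by exact: normr_ge0.
have M1 : 0 < M + 1 by rewrite ltr_wpDl.
pose s0 := r / (M + 1).
have s00 : 0 < s0 by rewrite divr_gt0.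
have s0M : s0 * M < r.
  have : s0 * (M + 1) = r by rewrite /s0 divfK// gt_eqF.
  lra.
pose s := geometric s0 (2^-1 : R).
have s_gt0 n : 0 < s n by rewrite /s/= mulr_gt0// exprn_gt0// invr_gt0.
have sS n : s n.+1 = s n / 2 by rewrite /s/= exprSr mulrA.
have s_le n m : (n <= m)%N -> s m <= s n.
  move=> /subnK <-; elim: (m - n)%N => // k IH.
  by rewrite addSn sS (le_trans _ IH)// ler_pdivrMr// ler_pMr// ler1n.
have s_cvg : s @ \oo --> (0 : R).
  by apply: cvg_geometric; rewrite gtr0_norm ?invr_gt0// invf_lt1// ltr1n.
have step n : exists a, catching_step x (s n) a.
  apply: catching_step_exists => //; apply: le_lt_trans s0M.
  rewrite ler_wpM2r//; have := s_le 0%N n isT.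
  by rewrite {2}/s/= expr0 mulr1.
have [a aP] := choice step.
pose A := 32 * M ^+ 3 / r.
have A0 : 0 <= A by rewrite divr_ge0 ?(ltW r_gt0)// mulr_ge0// exprn_ge0.
pose b n := `|a n| ^+ 2.
have cmp n m : (n < m)%N ->
    (s n + s m) * `|a n - a m| ^+ 2 <= (s n - s m) * (b m - b n) + A * s n ^+ 2.
  move=> nm; apply: catching_step_compare (aP n) (aP m) => //.
  by rewrite s_le// ltnW.
(* Halving the step makes [s n - s n.+1] comparable to [s n], so that the comparison
   bounds a possible decrease of the squared norms by [O(s n)], a summable error. *)
have b_mono n : b n - b n.+1 <= 2 * A * s n.
  have := cmp n n.+1 (ltnSn n); rewrite sS.
  have := s_gt0 n.
  have : 0 <= (s n + s n / 2) * `|a n - a n.+1| ^+ 2.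
    by rewrite mulr_ge0 ?sqr_ge0// addr_ge0// ?divr_ge0// ltW.
  move: (s n) (b n) (b n.+1) (_ * `| _ | ^+ 2) => k b1 b2 y y0 k0 h.
  rewrite -(ler_pM2l k0); nra.
have b_cvg : cvg (b @ \oo).
  pose c n := b n - 4 * A * s n.
  have c_cvg : cvg (c @ \oo).
    apply: nondecreasing_is_cvgn.
      apply/nondecreasing_seqP => n; rewrite /c sS.
      have := b_mono n; lra.
    exists (4 * M ^+ 2) => _ [n _ <-]; rewrite /c.
    have : b n <= (2 * M) ^+ 2.
      have aM := catching_step_norm (aP n) (lexx _).
      by rewrite /b ler_sqr ?nnegrE// mulr_ge0.
    have : 0 <= 4 * A * s n by rewrite mulr_ge0 ?(ltW (s_gt0 n))// mulr_ge0.
    rewrite exprMn; lra.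
  rewrite (_ : b = fun n => c n + 4 * A * s n); last first.
    by apply/funext => n; rewrite /c subrK.
  apply: is_cvgD => //; apply: is_cvgM; first exact: is_cvg_cst.
  by apply/cvg_ex; exists 0.
have a_cvg : cvg (a @ \oo).
  apply: cvg_cauchy_seq => e e0.
  have e4 : 0 < e ^+ 2 / 4 by rewrite divr_gt0// exprn_gt0.
  move: (b_cvg) => /cvgrPdist_le/(_ _ e4)[N _ bN].
  have eA : 0 < e ^+ 2 / (4 * (A + 1)).
    by rewrite divr_gt0 ?exprn_gt0// mulr_gt0// ltr_wpDl.
  move: (s_cvg) => /cvgrPdist_le/(_ _ eA)[N' _ sN'].
  exists (maxn N N') => n; rewrite leq_eqVlt => /predU1P[<-|mn].
    by rewrite subrr normr0 ltW.
  set m := maxn N N' in mn *.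
  have := cmp m n mn.
  have := bN m (leq_maxl _ _); have := bN n (leq_trans (leq_maxl _ _) (ltnW mn)).
  rewrite /= => bn bm.
  have bmn : `|b n - b m| <= e ^+ 2 / 2.
    have -> : b n - b m = (lim (b @ \oo) - b m) - (lim (b @ \oo) - b n).
      by ring.
    by rewrite (le_trans (ler_normB _ _))//; lra.
  have := sN' m (leq_maxr _ _); rewrite /= sub0r normrN gtr0_norm//.
  rewrite ler_pdivlMr ?mulr_gt0 ?ltr_wpDl// => sm h.
  rewrite distrC -ler_sqr ?nnegrE ?(ltW e0)//.
  have sn0 := s_gt0 n; have sm0 := s_gt0 m; have snm := s_le m n (ltnW mn).
  have sum0 : 0 < s m + s n by rewrite addr_gt0.
  rewrite -(ler_pM2l sum0); apply: le_trans h _.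
  have h1 : (s m - s n) * (b n - b m) <= (s m + s n) * (e ^+ 2 / 2).
    apply: (@le_trans _ _ ((s m - s n) * (e ^+ 2 / 2))).
      by rewrite ler_wpM2l ?subr_ge0// (le_trans (ler_norm _)).
    rewrite ler_wpM2r//; last by lra.
    by rewrite divr_ge0// sqr_ge0.
  have h2 : A * s m ^+ 2 <= (s m + s n) * (e ^+ 2 / 2).
    apply: (@le_trans _ _ (s m * (e ^+ 2 / 2))); last first.
      by rewrite ler_wpM2r ?divr_ge0 ?sqr_ge0//; lra.
    rewrite expr2 mulrCA ler_pM2l//; lra.
  lra.
pose g := lim (a @ \oo).
have ag : a @ \oo --> g by [].
have close e : 0 < e -> exists s a,
      [/\ 0 < s, s < e, catching_step x s a & `|a - g| <= e].
  move=> e0; move: (ag) => /cvgrPdist_le/(_ _ e0)[N _ aN].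
  move: (s_cvg) => /cvgrPdist_lt/(_ _ e0)[N' _ sN'].
  exists (s (maxn N N')), (a (maxn N N')); split => //.
    by have := sN' _ (leq_maxr N N'); rewrite /= sub0r normrN gtr0_norm.
  by rewrite distrC; apply: aN => /=; exact: leq_maxl.
exists g; split => //.
- apply: (hyponormal_closed Hip C_closed (c := fun n => x + s n *: a n)
    (v := fun n => f x - a n)).
  + by move=> n; have [] := aP n.
  + rewrite -[X in _ --> X]addr0 -(scale0r g).
    apply: cvgD; first exact: cvg_cst.
    by apply: cvgZ.
  + by apply: cvgB => //; exact: cvg_cst.
- apply/ler_addgt0Pr => e /close[k [y [_ _ [_ fy] yg]]].
  have -> : f x - g = (f x - y) + (y - g) by rewrite addrA subrK.
  by rewrite (le_trans (ler_normD _ _))// lerD.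
Qed.

End ProjectedVelocity.

(** * The catching-up algorithm *)

(** A perturbed trajectory: its right derivative [q] is close to [f c - v] for a uniform
normal [v] at a nearby point [c] of [C].  The radius [rad] bounds the positions and [M]
the size of [f] on them. *)
Definition approx_solution {R : realType} {H : completeNormedModType R}
  (ip : {dot H for (@idfun R)}) (r : R) (C : set H) (f : H -> H) (T M rad : R)
  (u0 : H) (eps : R) (u : R -> H) := [/\ u 0 = u0,
  forall s t : R, 0 <= s -> s <= t -> t <= T -> `|u t - u s| <= 2 * M * (t - s) &
  forall t : R, 0 <= t < T -> exists q c v,
    [/\ right_deriv u t q, hyponormal ip r C c v, `|v| <= M, 1 + `|c| <= rad &
        `|c - u t| <= eps /\ `|q - (f c - v)| <= eps] ].

Section Approximation.
Context {R : realType} {H : completeNormedModType R} (ip : {dot H for (@idfun R)}).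
Hypothesis Hip : norm_from_dot ip.
Variables (r : R) (C : set H) (f : H -> H) (T L K : R) (u0 : H).
Hypothesis r_gt0 : 0 < r.
Hypothesis C_prox : prox_regular r f C.
Hypotheses (L_gt0 : 0 < L) (K_ge0 : 0 <= K).
Hypothesis f_growth : forall x, `|f x| <= L * (1 + `|x|).
Hypothesis f_lip : forall x y, `|f x - f y| <= K * `|x - y|.
Hypothesis Cu0 : C u0.
Implicit Types (x c v q : H) (u w : R -> H) (s t h eps : R).

(** A priori bound of the discrete trajectory.  The horizon is [T + 1] because the last step,
of length at most 1, may end after [T]. *)
Definition radius := expR (2 * L * (T + 1)) * (1 + `|u0|).
Definition speed := L * radius.
Local Notation M := speed.

Lemma radius_gt0 : 0 < radius.
Proof. by rewrite mulr_gt0 ?expR_gt0// ltr_pwDl. Qed.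

Lemma speed_gt0 : 0 < M.
Proof. exact: mulr_gt0 radius_gt0. Qed.

Lemma field_le_speed x : 1 + `|x| <= radius -> `|f x| <= M.
Proof. by move=> xR; rewrite (le_trans (f_growth x))// ler_pM2l. Qed.

Section Polygon.
Variables (h : R) (A : H -> H).
Hypotheses (h_gt0 : 0 < h) (h_le1 : h <= 1) (hM : h * M < r).
Hypothesis AP : forall x, C x -> h * `|f x| < r -> catching_step ip r C f x h (A x).

Definition node k := iter k (fun x => x + h *: A x) u0.

Lemma nodeS k : node k.+1 = node k + h *: A (node k).
Proof. by []. Qed.

Lemma node_bound k : k%:R * h <= T + 1 ->
  C (node k) /\ 1 + `|node k| <= expR (2 * L * (k%:R * h)) * (1 + `|u0|).
Proof.
elim: k => [|k IH] kT.
  by rewrite /node/= mul0r mulr0 expR0 mul1r.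
have kT' : k%:R * h <= T + 1.
  by rewrite (le_trans _ kT)// ler_pM2r// ler_nat.
have [Ck kb] := IH kT'.
have kR : 1 + `|node k| <= radius.
  rewrite (le_trans kb)// ler_wpM2r ?addr_ge0// ler_expR ler_wpM2l//.
  by rewrite mulr_ge0// ltW.
have fk : h * `|f (node k)| < r.
  by rewrite (le_lt_trans _ hM)// ler_pM2l// field_le_speed.
have stp := AP Ck fk.
rewrite nodeS; split; first by have [[]] := stp.
have ak := catching_step_norm stp (lexx _).
apply: (@le_trans _ _ ((1 + `|node k|) * (1 + 2 * L * h))).
  have := ler_normD (node k) (h *: A (node k)).
  rewrite normrZ gtr0_norm//.
  have : h * `|A (node k)| <= h * (2 * (L * (1 + `|node k|))).
    rewrite ler_pM2l//; apply: (le_trans ak).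
    by rewrite ler_pM2l.
  lra.
have -> : 2 * L * (k.+1%:R * h) = 2 * L * (k%:R * h) + 2 * L * h.
  by rewrite -natr1; ring.
rewrite expRD [leRHS]mulrAC; apply: ler_pM => //.
  by rewrite addr_ge0// !mulr_ge0// ltW.
exact: expR_ge1Dx.
Qed.

Lemma node_step k : k%:R * h <= T ->
  [/\ catching_step ip r C f (node k) h (A (node k)), `|f (node k)| <= M,
      `|A (node k)| <= 2 * M & 1 + `|node k.+1| <= radius].
Proof.
move=> kT.
have kT1 : k%:R * h <= T + 1 by lra.
have kT2 : k.+1%:R * h <= T + 1 by rewrite -natr1; have := h_le1; lra.
have toR (b : R) x : b <= T + 1 -> 1 + `|x| <= expR (2 * L * b) * (1 + `|u0|) ->
    1 + `|x| <= radius.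
  move=> bT /le_trans; apply.
  rewrite ler_wpM2r ?addr_ge0// ler_expR ler_wpM2l//.
  by rewrite mulr_ge0// ltW.
have [Ck /(toR _ _ kT1) kb] := node_bound kT1.
have [_ /(toR _ _ kT2) kb'] := node_bound kT2.
have fk := field_le_speed kb.
have stp : catching_step ip r C f (node k) h (A (node k)).
  by apply: AP => //; rewrite (le_lt_trans _ hM)// ler_pM2l.
by split => //; exact: catching_step_norm stp fk.
Qed.

(** The interpolation of the nodes; the effective velocity is constant on each step. *)
Definition polygon t :=
  let k := Num.truncn (t / h) in node k + (t - k%:R * h) *: A (node k).

Lemma truncn_node t : 0 <= t ->
  (Num.truncn (t / h))%:R * h <= t < (Num.truncn (t / h)).+1%:R * h.
Proof.
move=> t0; have th : 0 <= t / h by rewrite divr_ge0// ltW.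
by rewrite -ler_pdivlMr// -ltr_pdivrMr//; exact: truncn_itv.
Qed.

(** The formula of a piece also holds at its right end, where the next piece starts. *)
Lemma polygonE k t : k%:R * h <= t <= k.+1%:R * h ->
  polygon t = node k + (t - k%:R * h) *: A (node k).
Proof.
move=> /andP[kt]; rewrite le_eqVlt => /predU1P[->|tk].
  rewrite /polygon mulfK ?gt_eqF// natrK subrr scale0r addr0 nodeS.
  by rewrite (_ : k.+1%:R * h - k%:R * h = h)// -natr1; ring.
rewrite /polygon (_ : Num.truncn (t / h) = k)//.
by apply: truncn_def; rewrite ler_pdivlMr// ltr_pdivrMr// kt.
Qed.

Lemma polygon_lipschitz s t : 0 <= s -> s <= t -> t <= T ->
  `|polygon t - polygon s| <= 2 * M * (t - s).
Proof.
move=> s0 st tT; have t0 := le_trans s0 st.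
pose j := Num.truncn (s / h); pose k := Num.truncn (t / h).
have /andP[js sj] : j%:R * h <= s < j.+1%:R * h := truncn_node s0.
have /andP[kt tk] : k%:R * h <= t < k.+1%:R * h := truncn_node t0.
have piece i (a b : R) : i%:R * h <= a -> a <= b -> b <= i.+1%:R * h -> a <= T ->
    `|polygon b - polygon a| <= 2 * M * (b - a).
  move=> ia ab bi aT.
  rewrite (@polygonE i a) ?ia ?(le_trans ab)//.
  rewrite (@polygonE i b) ?bi ?(le_trans ia)//.
  rewrite opprD addrACA subrr add0r -scalerBl.
  rewrite (_ : b - _ - _ = b - a); last by ring.
  rewrite normrZ ger0_norm ?subr_ge0// mulrC ler_wpM2r ?subr_ge0//.
  by have [] := node_step (le_trans ia aT).
have nodes i n : (j.+1 <= i)%N -> (i + n)%:R * h <= T ->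
    `|polygon ((i + n)%:R * h) - polygon (i%:R * h)| <= 2 * M * (n%:R * h).
  move=> ji; elim: n => [|n IH] iT.
    by rewrite addn0 subrr normr0 mul0r mulr0.
  have iT' : (i + n)%:R * h <= T.
    by rewrite (le_trans _ iT)// ler_pM2r// ler_nat leq_add2l.
  rewrite -(subrKA (polygon ((i + n)%:R * h))).
  rewrite (le_trans (ler_normD _ _))//.
  have -> : 2 * M * (n.+1%:R * h) = 2 * M * h + 2 * M * (n%:R * h).
    by rewrite -natr1; ring.
  apply: lerD; last exact: IH.
  rewrite addnS; apply: le_trans (piece (i + n)%N _ _ (lexx _) _ (lexx _) iT') _.
    by rewrite ler_pM2r// ler_nat.
  by rewrite -natr1; lra.
have : (j < k.+1)%N.
  by rewrite -(ltr_nat R) -(ltr_pM2r h_gt0); lra.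
rewrite ltnS leq_eqVlt => /predU1P[jk|jk].
  by apply: (piece k) => //; [rewrite -jk|rewrite ltW|lra].
have kT : k%:R * h <= T by lra.
have jkh : j.+1%:R * h <= k%:R * h by rewrite ler_pM2r// ler_nat.
have h1 : `|polygon t - polygon (k%:R * h)| <= 2 * M * (t - k%:R * h).
  by apply: (piece k) => //; exact: ltW.
have h2 : `|polygon (j.+1%:R * h) - polygon s| <= 2 * M * (j.+1%:R * h - s).
  by apply: (piece j) => //; [exact: ltW|lra].
have := @nodes j.+1 (k - j.+1)%N (leqnn _); rewrite subnKC// => /(_ kT).
rewrite natrB// => h3.
rewrite -(subrKA (polygon (k%:R * h))) -(subrKA (polygon (j.+1%:R * h)) (polygon (k%:R * h))).
have := ler_normD (polygon t - polygon (k%:R * h))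
  (polygon (k%:R * h) - polygon (j.+1%:R * h) + (polygon (j.+1%:R * h) - polygon s)).
have := ler_normD (polygon (k%:R * h) - polygon (j.+1%:R * h))
   (polygon (j.+1%:R * h) - polygon s).
lra.
Qed.

Lemma polygon_approx eps : 2 * M * (K + 1) * h <= eps ->
  approx_solution ip r C f T M radius u0 eps polygon.
Proof.
move=> heps; have M0 := speed_gt0.
have hM2 : 0 <= 2 * M * h by rewrite !mulr_ge0// ltW.
have hMK : 0 <= 2 * M * K * h by rewrite !mulr_ge0// ltW.
split.
- by rewrite (@polygonE 0%N)// !mul0r ?subrr ?scale0r ?addr0// lexx mul1r ltW.
- exact: polygon_lipschitz.
move=> t /andP[t0 tT].
pose k := Num.truncn (t / h).
have /andP[kt tk] : k%:R * h <= t < k.+1%:R * h := truncn_node t0.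
have [[kN fk'] fk ak kR] := node_step (le_trans kt (ltW tT)).
exists (A (node k)), (node k.+1), (f (node k) - A (node k)); split => //.
- move=> e e0; exists (k.+1%:R * h - t); split; first by rewrite subr_gt0.
  move=> d /andP[d0 dk].
  rewrite (@polygonE k t) ?kt ?(ltW tk)//.
  rewrite (@polygonE k (t + d)); last by apply/andP; split; lra.
  rewrite opprD addrACA subrr add0r -scalerBl -scalerBl.
  rewrite (_ : t + d - k%:R * h - (t - k%:R * h) - d = 0); last by ring.
  rewrite scale0r normr0.
  by rewrite mulr_ge0// ltW.
- exact: le_trans fk.
split.
  rewrite (@polygonE k t) ?kt ?(ltW tk)// nodeS opprD addrACA subrr add0r -scalerBl.
  rewrite normrZ.
  have -> : h - (t - k%:R * h) = k.+1%:R * h - t by rewrite -natr1; ring.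
  rewrite gtr0_norm ?subr_gt0//.
  have : (k.+1%:R * h - t) * `|A (node k)| <= h * (2 * M).
    apply: ler_pM => //; first by rewrite subr_ge0 ltW.
    by rewrite -natr1; have := h_le1; lra.
  lra.
have -> : A (node k) - (f (node k.+1) - (f (node k) - A (node k))) =
    f (node k) - f (node k.+1).
  by rewrite !opprB addrA subrKC.
rewrite (le_trans (f_lip _ _))// nodeS opprD addrA subrr add0r normrN normrZ gtr0_norm//.
have : K * (h * `|A (node k)|) <= K * (h * (2 * M)).
  by rewrite ler_wpM2l// ler_pM2l.
lra.
Qed.

End Polygon.

Lemma approx_solution_exists eps : 0 < eps ->
  exists u, approx_solution ip r C f T M radius u0 eps u.
Proof.
move=> eps0; have M0 := speed_gt0.
have Z0 : 0 < 2 * M * (K + 1) by rewrite mulr_gt0 ?ltr_wpDl// mulr_gt0.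
have M2 : 0 < 2 * M by exact: mulr_gt0.
pose h := Num.min 1 (Num.min (r / (2 * M)) (eps / (2 * M * (K + 1)))).
have h0 : 0 < h by rewrite !lt_min ltr01 !divr_gt0.
have h1 : h <= 1 by rewrite ge_min lexx.
have hr : h * (2 * M) <= r.
  by rewrite -ler_pdivlMr// !ge_min lexx orbT.
have heps : h * (2 * M * (K + 1)) <= eps.
  by rewrite -ler_pdivlMr// !ge_min lexx !orbT.
have hM : h * M < r by have := mulr_gt0 h0 M0; lra.
have step x : exists a, C x -> h * `|f x| < r -> catching_step ip r C f x h a.
  have [[Cx fx]|nx] := pselect (C x /\ h * `|f x| < r); last first.
    by exists 0 => Cx fx; exfalso; apply: nx.
  by have [a] := catching_step_exists Hip C_prox Cx h0 fx; exists a.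
have [A AP] := choice step.
exists (polygon h A); apply: polygon_approx => //.
by rewrite mulrC.
Qed.

End Approximation.

(** * Limit of the approximate solutions *)

Section Limit.
Context {R : realType} {H : completeNormedModType R} (ip : {dot H for (@idfun R)}).
Hypothesis Hip : norm_from_dot ip.
Variables (r : R) (C : set H) (f : H -> H) (T M rad K : R) (u0 : H).
Hypotheses (r_gt0 : 0 < r) (T_gt0 : 0 < T).
Hypotheses (M_gt0 : 0 < M) (K_ge0 : 0 <= K).
Hypothesis field_le : forall x, 1 + `|x| <= rad -> `|f x| <= M.
Hypothesis f_lip : forall x y, `|f x - f y| <= K * `|x - y|.
Implicit Types (x c v q : H) (u w : R -> H) (s t h eps : R).
Local Notation approx := (approx_solution ip r C f T M rad u0).

Definition one_sided_const := K + M / r.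
Local Notation K' := one_sided_const.

Let M2_ge0 : 0 <= 2 * M. Proof. by rewrite mulr_ge0// ltW. Qed.

Lemma one_sided_const_ge0 : 0 <= K'.
Proof. by rewrite addr_ge0// divr_ge0// ltW. Qed.

Lemma approx_bounded eps w s t : approx eps w -> 0 <= s <= T -> 0 <= t <= T ->
  `|w t - w s| <= 2 * M * T.
Proof.
move=> [_ wL _] /andP[s0 sT] /andP[t0 tT].
have k a b : 0 <= a -> b <= T -> a <= b -> `|w b - w a| <= 2 * M * T.
  move=> a0 bT ab; rewrite (le_trans (wL _ _ a0 ab bT))//.
  by rewrite (ler_wpM2l M2_ge0)//; lra.
by have [st|ts] := leP s t; [exact: k|rewrite distrC; apply: k => //; exact: ltW].
Qed.

Lemma approx_lip_AC eps w s t : approx eps w -> 0 <= s -> t <= T ->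
  absolutely_continuous s t w.
Proof.
move=> [_ wL _] s0 tT; apply: (AC_lipschitz (K := 2 * M)) => a b sa ab bt.
by apply: wL => //; [exact: le_trans sa|exact: le_trans tT].
Qed.

(** At each time the two right derivatives are close to [G = f c - v] and
[G' = f c' - v'], for which the one-sided Lipschitz estimate holds at [c] and [c'].
Replacing [c - c'] by the difference of the trajectories costs [O(eps + eps')]. *)
Lemma approx_compare eps eps' u w t : 0 <= eps <= 2^-1 -> 0 <= eps' <= 2^-1 ->
  approx eps u -> approx eps' w -> 0 <= t <= T ->
  `|u t - w t| ^+ 2 <=
    expR (4 * K' * T) * ((4 * K' + 8 * M + 8 * M * T) * T * (eps + eps')).
Proof.
move=> /andP[e0 e1] /andP[e'0 e'1] ua wa /andP[t0 tT].
pose eta := eps + eps'.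
have eta0 : 0 <= eta by rewrite addr_ge0.
have eta1 : eta <= 1 by rewrite /eta; lra.
have K0 := one_sided_const_ge0.
have MT : 0 <= M * T by rewrite mulr_ge0 ?ltW.
pose D := (4 * K' + 8 * M + 8 * M * T) * eta.
have Z0 : 0 <= 4 * K' + 8 * M + 8 * M * T by move: M_gt0 K0 MT => *; lra.
have D0 : 0 <= D by rewrite mulr_ge0.
have [uo uL uP] := ua; have [wo wL wP] := wa.
have uwB s : 0 <= s <= T -> `|u s - w s| <= 4 * M * T.
  move=> sT; have T0 : 0 <= (0 : R) <= T by rewrite lexx ltW.
  have h1 := approx_bounded ua T0 sT; have h2 := approx_bounded wa T0 sT.
  have -> : u s - w s = (u s - u 0) - (w s - w 0) by rewrite subr_pair uo wo subrr subr0.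
  by rewrite (le_trans (ler_normB _ _))//; lra.
have K4 : 0 <= 4 * K' by rewrite mulr_ge0.
have uwAC := AC_sub (approx_lip_AC ua (lexx 0) tT) (approx_lip_AC wa (lexx 0) tT).
have := gronwall_sqr_norm Hip t0 K4 D0 uwAC (B := 4 * M * T) _
  (negligible_set0 (@lebesgue_measure R)).
rewrite uo wo !subrr normr0 expr0n add0r subr0 => /(_ _ _)/wrap[].
- by move=> s /andP[s0 st]; apply: uwB; rewrite s0 (le_trans st).
- move=> s /andP[s0 st] _.
  have sT : 0 <= s < T by rewrite s0 (lt_le_trans st).
  have [q [c [v [uq cv vM cR [cu qG]]]]] := uP s sT.
  have [q' [c' [v' [wq cv' vM' cR' [cu' qG']]]]] := wP s sT.
  exists (q - q'); split; first exact: right_deriv_sub.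
  set G := f c - v in qG; set G' := f c' - v' in qG'.
  have GM : `|G| <= 2 * M.
    have := field_le cR.
    by move=> fc; rewrite (le_trans (ler_normB _ _))//; lra.
  have GM' : `|G'| <= 2 * M.
    have := field_le cR'.
    by move=> fc; rewrite (le_trans (ler_normB _ _))//; lra.
  have one := one_sided_lipschitz Hip r_gt0 f_lip cv cv' vM vM'.
  rewrite -/G -/G' -/K' in one.
  set d := u s - w s.
  have dB : `|d| <= 4 * M * T by apply: uwB; rewrite s0 ltW//; case/andP: sT.
  have cd : `|d - (c - c')| <= eta.
    rewrite /d subr_pair (le_trans (ler_normB _ _))// (distrC (u s)) (distrC (w s)).
    exact: lerD.
  have qd : `|(q - q') - (G - G')| <= eta.
    by rewrite subr_pair (le_trans (ler_normB _ _))//; exact: lerD.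
  have -> : ip d (q - q') = ip (G - G') (c - c') + ip (d - (c - c')) (G - G')
      + ip d ((q - q') - (G - G')).
    rewrite (ipC ip (G - G')) -ipDl [c - c' + _]addrC subrK -ipDr.
    by rewrite [G - G' + _]addrC subrK.
  have b1 : ip (d - (c - c')) (G - G') <= eta * (4 * M).
    rewrite (le_trans (ip_CS Hip _ _))// ler_pM//.
    by rewrite (le_trans (ler_normB _ _))//; lra.
  have b2 : ip d ((q - q') - (G - G')) <= 4 * M * T * eta.
    by rewrite (le_trans (ip_CS Hip _ _))// ler_pM.
  have b3 : `|c - c'| ^+ 2 <= 2 * `|d| ^+ 2 + 2 * eta.
    have : `|c - c'| <= `|d| + eta.
      have -> : c - c' = d - (d - (c - c')) by rewrite subKr.
      by rewrite (le_trans (ler_normB _ _))// lerD2l.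
    move=> h; apply: (@le_trans _ _ ((`|d| + eta) ^+ 2)).
      by rewrite ler_sqr ?nnegrE ?addr_ge0.
    have : eta ^+ 2 <= eta by rewrite expr2 ler_piMl.
    have := sqr_ge0 (`|d| - eta).
    move: (`|d|) => nd; nra.
  have b4 : K' * `|c - c'| ^+ 2 <= K' * (2 * `|d| ^+ 2 + 2 * eta).
    by rewrite ler_wpM2l.
  move: one b1 b2 b4; rewrite /D.
  clear; move: (ip _ _) (ip _ _) (ip _ _) (`|c - c'| ^+ 2) (`|d| ^+ 2) => a1 a2 a3 a4 a5.
  lra.
move=> h; apply: (le_trans h).
apply: ler_pM; rewrite ?expR_ge0 ?(mulr_ge0 D0)//.
  by rewrite ler_expR ler_wpM2l.
rewrite /D -/eta -mulrA -[leRHS]mulrA ler_wpM2l// mulrC.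
by rewrite ler_wpM2r.
Qed.

(** Pointwise convergence suffices: all the inequalities below are passed to the limit
at fixed times. *)
Lemma limit_exists :
  (forall eps : R, 0 < eps -> exists w, approx eps w) ->
  exists (u : R -> H) (w : nat -> R -> H) (eps : nat -> R),
  [/\ eps @ \oo --> (0 : R), forall n, 0 < eps n <= 2^-1,
      forall n, approx (eps n) (w n) &
      forall t, 0 <= t <= T -> (fun n => w n t) @ \oo --> u t].
Proof.
move=> approx_exists; pose eps n : R := 2^-1 / n.+1%:R.
have eps0 n : 0 < eps n by rewrite divr_gt0.
have eps_le n m : (n <= m)%N -> eps m <= eps n.
  by move=> nm; rewrite ler_pM2l// lef_pV2 ?posrE// ler_nat.
have eps1 n : eps n <= 2^-1.
  by apply: le_trans (eps_le 0%N n isT) _; rewrite /eps divr1.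
have eps_cvg : eps @ \oo --> (0 : R).
  rewrite -(mulr0 (2^-1)); apply: cvgM; first exact: cvg_cst.
  exact: cvg_harmonic.
have ex n : exists w, approx (eps n) w.
  by exact: approx_exists.
have [w wP] := choice ex.
exists (fun t => lim ((fun n => w n t) @ \oo)), w, eps; split => //.
  by move=> n; rewrite eps0 eps1.
move=> t tT; apply: cvg_cauchy_seq => e e0.
pose Z := expR (4 * K' * T) * ((4 * K' + 8 * M + 8 * M * T) * T).
have Z0 : 0 <= Z.
  rewrite mulr_ge0 ?expR_ge0// mulr_ge0 ?(ltW T_gt0)//.
  have := one_sided_const_ge0; have : 0 <= M * T by rewrite mulr_ge0// ltW.
  by move: M_gt0 => *; lra.
have [N ZN] : exists N, Z * (2 * eps N) <= e ^+ 2.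
  exists (Num.truncn (Z / e ^+ 2)).
  rewrite /eps (mulrA 2) mulfV// mul1r ler_pdivrMr// [leRHS]mulrC -ler_pdivrMr ?exprn_gt0//.
  exact/ltW/truncnS_gt.
exists N => n Nn.
have epsI m : 0 <= eps m <= 2^-1 by rewrite (ltW (eps0 m)) eps1.
have h := approx_compare (epsI n) (epsI N) (wP n) (wP N) tT.
rewrite -ler_sqr ?nnegrE ?(ltW e0)//; apply: (le_trans h); apply: le_trans ZN.
rewrite mulrA ler_wpM2l//; have := eps_le _ _ Nn; lra.
Qed.

End Limit.

(** The integrated form of [<u' - (f c - v), u - c> <= const |u - c|^2], which makes sense
before [u] is known to be derivable.  The point [x] may be either of [u s] and [u t]
(or any point close to both), and the error of this choice is the term [B (t - s)]: the
choice [x = u s] serves right derivatives, [x = u t] left derivatives. *)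
Definition evolves {R : realType} {H : normedModType R}
    (ip : {dot H for (@idfun R)}) (r : R) (C : set H) (f : H -> H) (T M B : R)
    (u : R -> H) :=
  forall c v : H, hyponormal ip r C c v -> `|v| <= M ->
  `|f c - v| <= 2 * M + 1 -> forall (s t : R) (x : H), 0 <= s -> s <= t -> t <= T ->
  `|x - u s| <= 2 * M * (t - s) -> `|x - u t| <= 2 * M * (t - s) ->
  ip (u t - u s) (x - c) <=
    (t - s) * (ip (f c - v) (x - c) + B * ((t - s) + `|x - c| ^+ 2)).

Section LimitEvolution.
Context {R : realType} {H : completeNormedModType R} (ip : {dot H for (@idfun R)}).
Hypothesis Hip : norm_from_dot ip.
Variables (r : R) (C : set H) (f : H -> H) (T M rad K : R) (u0 : H).
Hypothesis r_gt0 : 0 < r.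
Hypotheses (M_gt0 : 0 < M) (K_ge0 : 0 <= K).
Hypothesis field_le : forall x, 1 + `|x| <= rad -> `|f x| <= M.
Hypothesis f_lip : forall x y, `|f x - f y| <= K * `|x - y|.
Implicit Types (x c v q : H) (s t h : R).
Local Notation approx := (approx_solution ip r C f T M rad u0).
Local Notation K' := (one_sided_const r M K).

Let M2_ge0 : 0 <= 2 * M. Proof. by rewrite mulr_ge0// ltW. Qed.
Let K'_ge0 : 0 <= K'. Proof. exact: one_sided_const_ge0. Qed.

(** Along an approximate solution the derivative of [|w - c|^2] is estimated at each time by
the one-sided Lipschitz inequality between the local normal and [v]. *)
Lemma approx_evolves (eps : R) (w : R -> H) c v s t : 0 <= eps <= 1 -> approx eps w ->
  hyponormal ip r C c v -> `|v| <= M -> `|f c - v| <= 2 * M + 1 ->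
  0 <= s -> s <= t -> t <= T ->
  `|w t - c| ^+ 2 - `|w s - c| ^+ 2 <=
    2 * (t - s) * (ip (w s - c) (f c - v) + 2 * M * (t - s) * (2 * M + 1)
      + K' * (`|w s - c| + 2 * M * (t - s) + eps) ^+ 2
      + eps * (4 * M + 1 + (`|w s - c| + 2 * M * (t - s)))).
Proof.
move=> /andP[e0 e1] wa cv vM GM s0 st tT.
set G := f c - v in GM *; set k := t - s; set n := `|w s - c|.
have [wo wL wP] := wa.
have k0 : 0 <= k by rewrite subr_ge0.
have cAC : absolutely_continuous s t (fun=> c).
  by apply: (AC_lipschitz (K := 0)) => *; rewrite subrr normr0 mul0r.
have wcAC := AC_sub (approx_lip_AC wa s0 tT) cAC.
have wcB a : s <= a -> a <= t -> `|w a - w s| <= 2 * M * k.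
  move=> sa at_; rewrite (le_trans (wL s a s0 sa (le_trans at_ tT)))//.
  by rewrite (ler_wpM2l M2_ge0)// lerD2r.
have wcB' a : s <= a -> a <= t -> `|w a - c| <= n + 2 * M * k.
  move=> sa at_; have -> : w a - c = (w s - c) + (w a - w s).
    by rewrite [RHS]addrC addrA subrK.
  by rewrite (le_trans (ler_normD _ _))// lerD2l wcB.
set rho := n + 2 * M * k.
set Z := ip (w s - c) G + _ + _ + _.
have main : `|w t - c| ^+ 2 <= `|w s - c| ^+ 2 + 2 * Z * (t - s).
  apply: (dini_le (phi := fun a => `|w a - c| ^+ 2)) => //.
    by apply: (AC_sqr_norm (B := rho) wcAC) => a /andP[sa at_]; exact: wcB'.
  move=> a /andP[sa at_] e e_gt0.
  have [q [c1 [v1 [wq cv1 vM1 cR1 [cw qG]]]]] := 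
    wP a ltac:(by rewrite (le_trans s0)//= (lt_le_trans at_)).
  have wcq : right_deriv (fun a => w a - c) a q.
    rewrite -(subr0 q); apply: right_deriv_sub => // e2 e20; exists 1; split => // h /andP[h0 _].
    by rewrite subrr scaler0 subrr normr0 mulr_ge0// ltW.
  have [d [d0 wd]] := right_deriv_sqr_norm Hip wcq e_gt0.
  exists d; split => // h hd _; apply: (le_trans (wd h hd)).
  have /andP[h0 _] := hd.
  rewrite lerD2l ler_pM2l// lerD2r ler_pM2l//.
  set G1 := f c1 - v1 in qG.
  have GM1 : `|G1| <= 2 * M.
    have := field_le cR1.
    by move=> fc; rewrite (le_trans (ler_normB _ _))//; lra.
  have one := one_sided_lipschitz Hip r_gt0 f_lip cv1 cv vM1 vM.
  rewrite -/G -/G1 -/K' in one; clearbody G G1.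
  have -> : ip (w a - c) q = ip (w s - c) G + ip (w a - w s) G +
     ip (G1 - G) (c1 - c) + ip (w a - c1) (G1 - G) + ip (w a - c) (q - G1).
    by rewrite !(ipE ip) (ipC ip G1 c1) (ipC ip G1 c) (ipC ip G c1) (ipC ip G c); ring.
  have wac := wcB' a sa (ltW at_); have was := wcB a sa (ltW at_).
  have b1 : ip (w a - w s) G <= 2 * M * k * (2 * M + 1).
    by rewrite (le_trans (ip_CS Hip _ _))// ler_pM.
  have b2 : ip (w a - c1) (G1 - G) <= eps * (4 * M + 1).
    rewrite (le_trans (ip_CS Hip _ _))// ler_pM//; first by rewrite distrC.
    by rewrite (le_trans (ler_normB _ _))//; lra.
  have b3 : ip (w a - c) (q - G1) <= rho * eps.
    by rewrite (le_trans (ip_CS Hip _ _))// ler_pM.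
  have b4 : K' * `|c1 - c| ^+ 2 <= K' * (rho + eps) ^+ 2.
    have c1c : `|c1 - c| <= rho + eps.
      have -> : c1 - c = (w a - c) + (c1 - w a) by rewrite [RHS]addrC addrA subrK.
      by rewrite (le_trans (ler_normD _ _))// lerD.
    by rewrite ler_wpM2l// ler_sqr ?nnegrE// (le_trans _ c1c).
  rewrite /Z -/rho; clear -one b1 b2 b3 b4; lra.
by rewrite lerBlDl [2 * k * Z]mulrAC.
Qed.

End LimitEvolution.

Section LimitProperties.
Context {R : realType} {H : completeNormedModType R} (ip : {dot H for (@idfun R)}).
Hypothesis Hip : norm_from_dot ip.
Variables (r : R) (C : set H) (f : H -> H) (T M rad K : R) (u0 : H).
Hypotheses (r_gt0 : 0 < r) (C_closed : closed C) (T_gt0 : 0 < T).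
Hypotheses (M_gt0 : 0 < M) (K_ge0 : 0 <= K).
Hypothesis field_le : forall x, 1 + `|x| <= rad -> `|f x| <= M.
Hypothesis f_lip : forall x y, `|f x - f y| <= K * `|x - y|.
Implicit Types (x c v q : H) (s t h : R).
Local Notation approx := (approx_solution ip r C f T M rad u0).
Local Notation K' := (one_sided_const r M K).
Variables (u : R -> H) (w : nat -> R -> H) (eps : nat -> R).
Hypothesis eps_cvg : eps @ \oo --> (0 : R).
Hypothesis eps_itv : forall n, 0 < eps n <= 2^-1.
Hypothesis wP : forall n, approx (eps n) (w n).
Hypothesis wu : forall t, 0 <= t <= T -> (fun n => w n t) @ \oo --> u t.

Let M2_ge0 : 0 <= 2 * M. Proof. by rewrite mulr_ge0// ltW. Qed.
Let K'_ge0 : 0 <= K'. Proof. exact: one_sided_const_ge0. Qed.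

Lemma limit_start : u 0 = u0.
Proof.
have T0 : 0 <= (0 : R) <= T by rewrite lexx ltW.
rewrite -(cvg_lim (@norm_hausdorff _ _) (wu T0)).
rewrite (_ : (fun n => _) = (fun=> u0)) ?lim_cst//.
by apply/funext => n; have [] := wP n.
Qed.

Lemma limit_lipschitz s t : 0 <= s -> s <= t -> t <= T ->
  `|u t - u s| <= 2 * M * (t - s).
Proof.
move=> s0 st tT.
have ws : (fun n => w n s) @ \oo --> u s by apply: wu; rewrite s0 (le_trans st).
have wt : (fun n => w n t) @ \oo --> u t by apply: wu; rewrite tT (le_trans s0).
apply: (ler_cvg_to (cvg_norm (cvgB wt ws)) (cvg_cst (2 * M * (t - s)))).
by apply: nearW => n; have [_ wL _] := wP n; exact: wL.
Qed.

(** The points [c] attached to the approximate solutions converge to the limit.  They are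
defined only before [T]; the final time is reached by continuity. *)
Lemma limit_near t e : 0 <= t <= T -> 0 < e ->
  exists c, [/\ C c, 1 + `|c| <= rad & `|c - u t| <= e].
Proof.
suff near s : forall e : R, 0 <= s < T -> 0 < e ->
    exists c, [/\ C c, 1 + `|c| <= rad & `|c - u s| <= e].
  move=> /andP[t0 tT] e0; move: tT; rewrite le_eqVlt => /predU1P[tT|tT]; last first.
    by apply: near; rewrite ?t0.
  have M4 : 0 < 4 * M by rewrite mulr_gt0.
  pose s := Num.max 0 (T - e / (4 * M)).
  have s0 : 0 <= s by rewrite le_max lexx.
  have sT : s < T by rewrite gt_max T_gt0 gtrBl divr_gt0.
  have [c [Cc cR cs]] := near s (e / 2) ltac:(by rewrite s0) ltac:(by rewrite divr_gt0).
  exists c; split => //; rewrite tT.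
  have := limit_lipschitz s0 (ltW sT) (lexx T).
  have : (T - s) * (4 * M) <= e.
    rewrite -ler_pdivlMr// lerBlDl -lerBlDr le_max lexx orbT//.
  have -> : c - u T = (c - u s) - (u T - u s) by rewrite opprB addrA subrK.
  by move=> h1 h2; rewrite (le_trans (ler_normB _ _))//; lra.
move=> e0 /andP[s0 sT] e_gt0.
have e2 : 0 < e0 / 2 by rewrite divr_gt0.
have sT' : 0 <= s <= T by rewrite s0 ltW.
have /cvgrPdist_le/(_ _ e2)[N _ uN] := wu sT'.
have /cvgrPdist_le/(_ _ e2)[N' _ eN] := eps_cvg.
pose n := maxn N N'.
have := uN n (leq_maxl _ _); have := eN n (leq_maxr _ _).
rewrite /= sub0r normrN gtr0_norm; last by case/andP: (eps_itv n).
have [_ _ wn] := wP n.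
have [q [c [v [_ [Cc _] _ cR [cw _]]]]] := wn s ltac:(by rewrite s0).
move=> en un; exists c; split => //.
have -> : c - u s = (c - w n s) - (u s - w n s) by rewrite opprB addrA subrK.
by rewrite (le_trans (ler_normB _ _))//; lra.
Qed.

Lemma limit_in_C t : 0 <= t <= T -> C (u t).
Proof.
move=> tT; apply: contrapT => nC.
have : nbhs (u t) (~` C) by apply: open_nbhs_nbhs; split => //; exact: closed_openC.
move=> /nbhs_ballP[e /= e0 eC].
have [c [Cc _ cu]] := limit_near tT (ltac:(by rewrite divr_gt0) : 0 < e / 2).
apply: (eC c) => //; rewrite -ball_normE/= distrC (le_lt_trans cu)//.
by rewrite ltr_pdivrMr// ltr_pMr// ltr1n.
Qed.

Lemma limit_radius t : 0 <= t <= T -> 1 + `|u t| <= rad.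
Proof.
move=> tT; apply/ler_addgt0Pr => e e0.
have [c [_ cR cu]] := limit_near tT e0.
have -> : u t = c - (c - u t) by rewrite subKr.
have := ler_normB c (c - u t); lra.
Qed.

Lemma limit_evolves : exists B, 0 <= B /\ evolves ip r C f T M B u.
Proof.
have G00 : 0 <= 2 * M + 1 by rewrite addr_ge0.
pose B := 4 * M * (2 * M + 1) + 2 * K' + 32 * K' * M ^+ 2 * T + 2 * M ^+ 2.
have Msq : 0 <= M ^+ 2 by exact: sqr_ge0.
have KT : 0 <= K' * M ^+ 2 * T by rewrite !mulr_ge0// ltW.
have MG : 0 <= M * (2 * M + 1) by rewrite mulr_ge0// ltW.
exists B; split.
  by move: Msq KT MG K'_ge0; rewrite /B; move: (K') => k1 *; lra.
move=> c v cv vM GM s t x s0 st tT xs xt.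
set G := f c - v in GM *; set k := t - s in xs xt *.
have k0 : 0 <= k by rewrite subr_ge0.
have kT : k <= T by rewrite /k; lra.
have sT : 0 <= s <= T by rewrite s0 (le_trans st).
have t0T : 0 <= t <= T by rewrite tT (le_trans s0).
have main : `|u t - c| ^+ 2 - `|u s - c| ^+ 2 <=
    2 * k * (ip (u s - c) G + 2 * M * k * (2 * M + 1)
      + K' * (`|u s - c| + 2 * M * k) ^+ 2).
  have wtc : (fun n => w n t - c) @ \oo --> u t - c.
    by apply: cvgB; [exact: wu|exact: cvg_cst].
  have wsc : (fun n => w n s - c) @ \oo --> u s - c.
    by apply: cvgB; [exact: wu|exact: cvg_cst].
  have l1 : (fun n => `|w n t - c| ^+ 2 - `|w n s - c| ^+ 2) @ \oo -->
      `|u t - c| ^+ 2 - `|u s - c| ^+ 2 by apply: cvgB; exact: cvg_sqr_norm.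
  have n1 : (fun n => `|w n s - c| + 2 * M * k) @ \oo --> `|u s - c| + 2 * M * k.
    by apply: cvgD; [exact: cvg_norm|exact: cvg_cst].
  have n2 : (fun n => (`|w n s - c| + 2 * M * k + eps n) ^+ 2) @ \oo -->
      (`|u s - c| + 2 * M * k) ^+ 2.
    have n0 : (fun n => `|w n s - c| + 2 * M * k + eps n) @ \oo -->
        `|u s - c| + 2 * M * k by rewrite -[X in _ --> X]addr0; exact: cvgD.
    by rewrite expr2; exact: cvgM.
  have n3 : (fun n => eps n * (4 * M + 1 + (`|w n s - c| + 2 * M * k))) @ \oo --> (0 : R).
    rewrite -(mul0r (4 * M + 1 + (`|u s - c| + 2 * M * k))).
    by apply: cvgM => //; apply: cvgD => //; exact: cvg_cst.
  have l2 : (fun n => 2 * k * (ip (w n s - c) G + 2 * M * k * (2 * M + 1)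
      + K' * (`|w n s - c| + 2 * M * k + eps n) ^+ 2
      + eps n * (4 * M + 1 + (`|w n s - c| + 2 * M * k)))) @ \oo -->
     2 * k * (ip (u s - c) G + 2 * M * k * (2 * M + 1)
      + K' * (`|u s - c| + 2 * M * k) ^+ 2 + 0).
    apply: cvgM; first exact: cvg_cst.
    apply: cvgD => //; apply: cvgD.
      by apply: cvgD; [apply: cvg_ip => //; exact: cvg_cst|exact: cvg_cst].
    by apply: cvgM => //; exact: cvg_cst.
  rewrite addr0 in l2; apply: (ler_cvg_to l1 l2); apply: nearW => n.
  apply: (approx_evolves Hip r_gt0 M_gt0 K_ge0 field_le f_lip _ (wP n) cv vM GM s0 st tT).
  have /andP[e0 e1] := eps_itv n.
  by rewrite (ltW e0) (le_trans e1)// invf_le1// ler1n.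
set y := x - c.
have dE a : u a - c = y - (x - u a) by rewrite /y opprB [RHS]addrC addrA subrK.
clearbody y.
have h1 : ip (u s - c) G <= ip G y + 2 * M * k * (2 * M + 1).
  rewrite dE ipDl ipNl (ipC ip y G) lerD2l.
  have := ip_CS_ge Hip (x - u s) G.
  have : `|x - u s| * `|G| <= 2 * M * k * (2 * M + 1) by exact: ler_pM.
  lra.
have h2 : (`|u s - c| + 2 * M * k) ^+ 2 <= 2 * `|y| ^+ 2 + 32 * M ^+ 2 * T * k.
  have us : `|u s - c| + 2 * M * k <= `|y| + 4 * M * k.
    by rewrite dE; have := ler_normB y (x - u s); lra.
  apply: (@le_trans _ _ ((`|y| + 4 * M * k) ^+ 2)).
    rewrite ler_sqr ?nnegrE//.
      by rewrite addr_ge0// mulr_ge0.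
    by rewrite (le_trans _ us)// addr_ge0// mulr_ge0.
  have : M ^+ 2 * k * k <= M ^+ 2 * k * T by rewrite ler_wpM2l// mulr_ge0.
  have := sqr_ge0 (`|y| - 4 * M * k).
  move: (`|y|) => ny; lra.
have e1 : `|u t - c| ^+ 2 - `|u s - c| ^+ 2 =
    2 * ip (u t - u s) y + `|x - u t| ^+ 2 - `|x - u s| ^+ 2.
  rewrite -!(ip_normE Hip) !dE (_ : u t - u s = (x - u s) - (x - u t)).
    move: (x - u s) (x - u t) => a b; rewrite !(ipE ip) (ipC ip y a) (ipC ip y b); ring.
  by rewrite subr_pair subrr sub0r opprB.
have h3 : `|x - u s| ^+ 2 <= (2 * M * k) ^+ 2.
  by rewrite ler_sqr ?nnegrE// (le_trans _ xs).
have h4 : K' * (`|u s - c| + 2 * M * k) ^+ 2 <=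
    K' * (2 * `|y| ^+ 2 + 32 * M ^+ 2 * T * k) by rewrite ler_wpM2l.
have h5 : 0 <= `|x - u t| ^+ 2 by exact: sqr_ge0.
have h6 : k * (ip (u s - c) G + 2 * M * k * (2 * M + 1) + K' * (`|u s - c| + 2 * M * k) ^+ 2) <=
   k * (ip G y + 2 * M * k * (2 * M + 1) + 2 * M * k * (2 * M + 1) +
     K' * (2 * `|y| ^+ 2 + 32 * M ^+ 2 * T * k)).
  by rewrite ler_wpM2l// lerD// lerD.
rewrite e1 in main.
have h7 : 0 <= k * `|y| ^+ 2 * (4 * M * (2 * M + 1) + 32 * K' * M ^+ 2 * T + 2 * M ^+ 2).
  rewrite mulr_ge0 ?mulr_ge0 ?sqr_ge0//; lra.
have h8 : 0 <= k * k * K' by rewrite !mulr_ge0.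
move: main h3 h5 h6 h7 h8; rewrite /B.
move: (ip _ _) (ip _ _) (ip _ _) (`|x - u t| ^+ 2) (`|x - u s| ^+ 2) (`|y| ^+ 2) (_ ^+ 2)
  => a1 a2 a3 a4 a5 a6 a7.
lra.
Qed.

End LimitProperties.

(** * Differentiability of the limit *)

Section Differentiability.
Context {R : realType} {H : completeNormedModType R} (ip : {dot H for (@idfun R)}).
Hypothesis Hip : norm_from_dot ip.
Variables (r : R) (C : set H) (f : H -> H) (T M K B : R) (u : R -> H).
Hypothesis r_gt0 : 0 < r.
Hypotheses (M_gt0 : 0 < M) (K_ge0 : 0 <= K) (B_ge0 : 0 <= B).
Hypothesis f_lip : forall x y, `|f x - f y| <= K * `|x - y|.
Hypothesis u_C : forall t, 0 <= t <= T -> C (u t).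
Hypothesis u_M : forall t, 0 <= t <= T -> `|f (u t)| <= M.
Hypothesis u_lip : forall s t, 0 <= s -> s <= t -> t <= T ->
  `|u t - u s| <= 2 * M * (t - s).
Hypothesis u_evolves : evolves ip r C f T M B u.
Implicit Types (x c v q g : H) (s t h k e : R).
Local Notation K' := (one_sided_const r M K).

Let M2_ge0 : 0 <= 2 * M. Proof. by rewrite mulr_ge0// ltW. Qed.
Let K'_ge0 : 0 <= K'. Proof. exact: one_sided_const_ge0. Qed.

(** The geometric core of differentiability.  Test the inequality with the catching-up
point [c = x + s a], for which [x - c = - s a] and [f c - v] is [a] up to [O(s)]: it
becomes [<q, a> >= |a|^2 - O(s) - O(k / s)].  Together with [|q| <= |g| + d] and [a]
close to [g] this forces [q] to be close to [g].  The step [s] is fixed first, and then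
[k] is taken small compared with [s]. *)
Lemma velocity_attracts x g : C x -> `|f x| <= M ->
  projected_velocity ip r C f x g -> forall eta : R, 0 < eta ->
  exists d : R, 0 < d /\ forall k q, 0 < k < d -> `|q| <= `|g| + d ->
    (forall c v, hyponormal ip r C c v -> `|v| <= M -> `|f c - v| <= 2 * M + 1 ->
       ip q (x - c) <= ip (f c - v) (x - c) + B * (k + `|x - c| ^+ 2)) ->
    `|q - g| <= eta.
Proof.
move=> Cx fM [_ _ gapp] eta eta0.
(* [e * Z] will bound the squared distance of [q] to the approximate velocity [a]. *)
pose Z := 8 * M + 4 + 8 * M ^+ 2 * K + 8 * B * M ^+ 2 + 2 * B.
have Msq : 0 <= M ^+ 2 by exact: sqr_ge0.
have MK : 0 <= M ^+ 2 * K by rewrite mulr_ge0.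
have BM : 0 <= B * M ^+ 2 by rewrite mulr_ge0.
have Z0 : 0 < Z by have := M_gt0; have := B_ge0; rewrite /Z; lra.
have MK1 : 0 < 2 * M * K + 1 by rewrite ltr_wpDl// mulr_ge0.
pose e := Num.min (Num.min 1 (eta / 2))
  (Num.min (2 * M * K + 1)^-1 ((eta / 2) ^+ 2 / Z)).
have eta2 : 0 < eta / 2 by rewrite divr_gt0.
have e0 : 0 < e by rewrite !lt_min ltr01 eta2 invr_gt0 MK1 divr_gt0// exprn_gt0.
have e1 : e <= 1 by rewrite !ge_min lexx.
have e2 : e <= eta / 2 by rewrite !ge_min lexx orbT.
have e3 : e * (2 * M * K + 1) <= 1.
  by rewrite -ler_pdivlMr// div1r !ge_min lexx !orbT.
have e4 : e * Z <= (eta / 2) ^+ 2 by rewrite -ler_pdivlMr// !ge_min lexx !orbT.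
clearbody e.
have [s [a [s0 se stp ag]]] := gapp e e0.
have aM := catching_step_norm stp fM.
have [cv vfM] := stp.
exists (e * s); split; first exact: mulr_gt0.
move=> k q /andP[k0 kes] qg qE.
set c := x + s *: a in cv; set v := f x - a in cv vfM.
have cx : `|c - x| <= s * (2 * M).
  by rewrite /c addrC addKr normrZ gtr0_norm// ler_pM2l.
have fcx : `|f c - f x| <= K * (s * (2 * M)).
  by rewrite (le_trans (f_lip _ _))// ler_wpM2l.
have fcv : f c - v = a + (f c - f x).
  by rewrite /v opprB addrCA.
have se2 : s * (M * K) <= e * (M * K).
  by rewrite ler_wpM2r ?mulr_ge0// ltW.
have GM : `|f c - v| <= 2 * M + 1.
  by rewrite fcv (le_trans (ler_normD _ _))//; lra.
have xc : x - c = - (s *: a) by rewrite /c opprD addrA subrr add0r.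
have := qE c v cv (le_trans vfM fM) GM.
rewrite xc fcv normrN normrZ gtr0_norm// !(ipNr, ipZr) ipDl (ip_normE Hip).
set w := f c - f x in fcx *.
move=> main.
have wa : - (4 * M ^+ 2 * K * s) <= ip w a.
  apply: le_trans (ip_CS_ge Hip w a); rewrite lerN2.
  have : `|w| * `|a| <= K * (s * (2 * M)) * (2 * M) by exact: ler_pM.
  lra.
have qa : `|a| ^+ 2 - e * (4 * M ^+ 2 * K + B + 4 * B * M ^+ 2) <= ip q a.
  have na : `|a| ^+ 2 <= 4 * M ^+ 2.
    rewrite (_ : 4 * M ^+ 2 = (2 * M) ^+ 2); last by ring.
    by rewrite ler_sqr ?nnegrE.
  rewrite -(ler_pM2l s0).
  have h1 : B * k <= B * (e * s) by rewrite ler_wpM2l// ltW.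
  have h2 : B * (s * `|a|) ^+ 2 <= B * (s * (e * (4 * M ^+ 2))).
    rewrite ler_wpM2l// exprMn expr2 -mulrA ler_pM2l//.
    by rewrite ler_pM ?sqr_ge0 ?(ltW s0) ?(ltW se).
  have h3 : s * - (4 * M ^+ 2 * K * s) <= s * ip w a by rewrite ler_pM2l.
  have h4 : s * (M ^+ 2 * K * s) <= s * (M ^+ 2 * K * e).
    by rewrite ler_pM2l// ler_wpM2l// ltW.
  move: main h1 h2 h3 h4; clearbody w.
  move: (ip q a) (ip w a) (`|a| ^+ 2) ((s * `|a|) ^+ 2) => x1 x2 x3 x4 *; lra.
have es : e * s <= e by rewrite ger_pMr// (le_trans (ltW se)).
have nq : `|q| <= `|a| + 2 * e.
  have : `|g| <= `|a| + e.
    have -> : g = a - (a - g) by rewrite subKr.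
    by rewrite (le_trans (ler_normB _ _))// lerD2l.
  lra.
have nq2 : `|q| ^+ 2 <= `|a| ^+ 2 + e * (8 * M + 4).
  apply: (@le_trans _ _ ((`|a| + 2 * e) ^+ 2)).
    by rewrite ler_sqr ?nnegrE// (le_trans _ nq).
  have : e * `|a| <= e * (2 * M) by rewrite ler_pM2l.
  have : e * e <= e * 1 by rewrite ler_pM2l.
  lra.
have qa2 : `|q - a| <= eta / 2.
  rewrite -ler_sqr ?nnegrE ?(ltW eta2)//; apply: le_trans e4.
  rewrite (sqr_normD Hip) ipNr normrN /Z; move: nq2 qa.
  move: (ip q a) (`|a| ^+ 2) (`|q| ^+ 2) => x1 x2 x3 *; lra.
have -> : q - g = (q - a) + (a - g) by rewrite addrA subrK.
by rewrite (le_trans (ler_normD _ _))//; lra.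
Qed.

(** With [x = u s], [c = x] and [v = f x - g], the evolution inequality bounds the growth of
[rho = |u - x|] by [rho rho' <= a rho], where [a] is close to [|g|].  Dividing by
[rho] is avoided by improving a linear bound iteratively. *)
Lemma speed_bound s t g : 0 <= s -> s <= t -> t <= T ->
  projected_velocity ip r C f (u s) g ->
  `|u t - u s| <= (`|g| + 2 * M * B * (t - s)) * (t - s).
Proof.
move=> s0 st tT [gN gf _].
set x := u s in gN gf *.
have sT : 0 <= s <= T by rewrite s0 (le_trans st).
have fM := u_M sT.
pose k := t - s.
have k0 : 0 <= k by rewrite subr_ge0.
pose a := `|g| + 2 * M * B * k.
have a0 : 0 <= a by rewrite addr_ge0// !mulr_ge0// ltW.
have gM : `|g| <= 2 * M + 1.
  have -> : g = f x - (f x - g) by rewrite subKr.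
  by rewrite (le_trans (ler_normB _ _))//; move: gf fM; rewrite -/x; lra.
have evol p h : s <= p -> 0 < h -> p + h <= t ->
    ip (u (p + h) - u p) (u p - x) <= h * (ip g (u p - x) + B * (h + `|u p - x| ^+ 2)).
  move=> sp h0 pht.
  have := u_evolves gN (le_trans gf fM) _ (s := p) (t := p + h) (x := u p).
  rewrite subKr (_ : p + h - p = h); last by ring.
  apply => //; [exact: le_trans sp|lra|exact: le_trans tT| |].
    by rewrite subrr normr0 !mulr_ge0// ltW.
  rewrite distrC (le_trans (u_lip _ _ _))//.
  - exact: le_trans sp.
  - lra.
  - exact: le_trans tT.
  - by rewrite (_ : p + h - p = h)//; ring.
have rho_lip p : s <= p -> p <= t -> `|u p - x| <= 2 * M * k.
  move=> sp pt; rewrite (le_trans (u_lip s0 sp (le_trans pt tT)))//.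
  by rewrite (ler_wpM2l M2_ge0)// lerD2r.
(* If [rho p <= b (p - s)], then the squared distance grows at rate at most
   [2 a b (p - s)]; hence [rho p <= sqrt (a b) (p - s)], and the geometric mean is at most
   the arithmetic one. *)
have half b : 0 <= b -> (forall p, s <= p <= t -> `|u p - x| <= b * (p - s)) ->
    forall p, s <= p <= t -> `|u p - x| <= (a + b) / 2 * (p - s).
  move=> b0 ub p /andP[sp pt].
  have ab0 : 0 <= a * b by rewrite mulr_ge0.
  have uxAC : absolutely_continuous s p (fun p => u p - x).
    apply: AC_sub.
      apply: (AC_lipschitz (K := 2 * M)) => y z sy yz zp; apply: u_lip => //.
        exact: le_trans sy.
      by rewrite (le_trans zp)// (le_trans pt).
    by apply: (AC_lipschitz (K := 0)) => *; rewrite subrr normr0 mul0r.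
  have sqAC : absolutely_continuous s p (fun y => `|u y - x| ^+ 2).
    apply: (AC_sqr_norm (B := 2 * M * k) uxAC) => y /andP[sy yp].
    by apply: rho_lip => //; exact: le_trans pt.
  have quadAC : absolutely_continuous s p (fun y : R => a * b * (y - s) ^+ 2).
    apply: (AC_lipschitz (K := a * b * (2 * (p - s)))) => y z sy yz zp.
    rewrite -mulrBr (_ : _ - _ = (z + y - 2 * s) * (z - y)); last by ring.
    have h1 : 0 <= z + y - 2 * s by lra.
    have h2 : 0 <= z - y by lra.
    rewrite ger0_norm; last by rewrite mulr_ge0// mulr_ge0.
    rewrite -[leRHS]mulrA ler_wpM2l// ler_wpM2r//; lra.
  have : `|u p - x| ^+ 2 - a * b * (p - s) ^+ 2 <=
      `|u s - x| ^+ 2 - a * b * (s - s) ^+ 2 + 0 * (p - s).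
    apply: (dini_le (phi := fun y => `|u y - x| ^+ 2 - a * b * (y - s) ^+ 2)) => //.
      exact: AC_sub.
    move=> y /andP[sy yp] e e0.
    have Z0 : 0 < 4 * M ^+ 2 + 2 * B + 1.
      by have := sqr_ge0 M; move: B_ge0; lra.
    exists (e / (4 * M ^+ 2 + 2 * B + 1)); split; first exact: divr_gt0.
    move=> h /andP[h0]; rewrite ltr_pdivlMr// => hZ yhp.
    have yht : y + h <= t by rewrite (le_trans yhp).
    have ev := evol y h sy h0 yht.
    have yt : s <= y <= t by rewrite sy (le_trans (ltW yp)).
    have := ub y yt; have : `|u y - x| <= 2 * M * k by apply: rho_lip => //; lra.
    set n := `|u y - x| in ev *.
    have n0 : 0 <= n by exact: normr_ge0.
    move=> nMk nb.
    have du : `|u (y + h) - u y| ^+ 2 <= (2 * M * h) ^+ 2.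
      rewrite ler_sqr ?nnegrE//; last by rewrite mulr_ge0// ltW.
      rewrite (le_trans (u_lip _ _ _))//; [exact: le_trans sy|lra|exact: le_trans tT|].
      by rewrite (_ : y + h - y = h)//; ring.
    have -> : `|u (y + h) - x| ^+ 2 =
        n ^+ 2 + 2 * ip (u (y + h) - u y) (u y - x) + `|u (y + h) - u y| ^+ 2.
      rewrite (_ : u (y + h) - x = (u y - x) + (u (y + h) - u y)).
        by rewrite (sqr_normD Hip) (ipC ip (u y - x)).
      by rewrite [RHS]addrC addrA subrK.
    have gi : ip g (u y - x) <= `|g| * n by exact: ip_CS.
    have an : `|g| * n + B * n ^+ 2 <= a * (b * (y - s)).
      apply: (@le_trans _ _ (a * n)); last by rewrite ler_wpM2l.
      have : B * n * n <= B * n * (2 * M * k) by rewrite ler_wpM2l// mulr_ge0.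
      rewrite /a; lra.
    have h2 : h * (`|g| * n + B * n ^+ 2) <= h * (a * (b * (y - s))).
      by rewrite ler_pM2l.
    have h3 : h * ip g (u y - x) <= h * (`|g| * n) by rewrite ler_pM2l.
    have h4 : h * (h * (4 * M ^+ 2 + 2 * B + 1)) <= h * e by rewrite ler_pM2l// ltW.
    have h5 : 0 <= a * b * h ^+ 2 by rewrite mulr_ge0// sqr_ge0.
    have h6 : 0 <= h * h by rewrite mulr_ge0// ltW.
    move: ev du h2 h3 h4 h5 h6.
    move: (ip _ _) (ip _ _) (`|_ - _| ^+ 2) => x1 x2 x3; clearbody n a.
    move=> *; lra.
  rewrite /x !subrr normr0 expr0n /= mulr0 subr0 mul0r addr0 subr_le0 -/x => h.
  have ps : 0 <= p - s by rewrite subr_ge0.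
  rewrite -ler_sqr ?nnegrE//; last by rewrite mulr_ge0// divr_ge0// addr_ge0.
  apply: (le_trans h); rewrite exprMn ler_wpM2r ?sqr_ge0//.
  by have := sqr_ge0 (a - b); lra.
have iter n p : s <= p <= t -> `|u p - x| <= (a + 2 * M * 2^-1 ^+ n) * (p - s).
  elim: n p => [|n IH] p /andP[sp pt].
    rewrite expr0 mulr1 (le_trans (u_lip s0 sp (le_trans pt tT)))//.
    by rewrite ler_wpM2r ?subr_ge0// lerDr.
  have b0 : 0 <= a + 2 * M * 2^-1 ^+ n.
    by rewrite addr_ge0// mulr_ge0// exprn_ge0// invr_ge0.
  have := half _ b0 IH p; rewrite sp pt => /(_ isT) h; apply: (le_trans h).
  by rewrite le_eqVlt exprS; apply/orP; left; apply/eqP; field.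
have lim_geo : (fun n => (a + 2 * M * 2^-1 ^+ n) * (t - s)) @ \oo --> (a + 2 * M * 0) * (t - s).
  apply: cvgM; last exact: cvg_cst.
  apply: cvgD; first exact: cvg_cst.
  apply: cvgM; first exact: cvg_cst.
  by apply: cvg_expr; rewrite gtr0_norm ?invr_gt0// invf_lt1// ltr1n.
rewrite mulr0 addr0 in lim_geo.
apply: (ler_cvg_to (cvg_cst `|u t - x|) lim_geo); apply: nearW => n.
by apply: iter; rewrite st lexx.
Qed.

Variable G : H -> H.
Hypothesis G_velocity : forall t, 0 <= t <= T ->
  projected_velocity ip r C f (u t) (G (u t)).

Lemma evolution_right_deriv t : 0 <= t -> t < T -> right_deriv u t (G (u t)).
Proof.
move=> t0 tT e e0.
have tT' : 0 <= t <= T by rewrite t0 ltW.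
have [d [d0 dP]] := velocity_attracts (u_C tT') (u_M tT') (G_velocity tT') e0.
have Z0 : 0 < 2 * M * B + 1 by rewrite ltr_wpDl// mulr_ge0.
exists (Num.min (Num.min d (T - t)) (d / (2 * M * B + 1))); split.
  by rewrite !lt_min d0 subr_gt0 tT divr_gt0.
move=> h /andP[h0]; rewrite !lt_min ltr_pdivlMr// => /andP[/andP[hd hT] hZ].
have thT : t + h <= T by lra.
have quotE : u (t + h) - u t = h *: (h^-1 *: (u (t + h) - u t)).
  by rewrite scalerA mulfV ?gt_eqF// scale1r.
have nquot : h * `|h^-1 *: (u (t + h) - u t)| = `|u (t + h) - u t|.
  by rewrite [in RHS]quotE [RHS]normrZ gtr0_norm.
rewrite [X in X - _]quotE -scalerBr normrZ gtr0_norm// mulrC ler_pM2r//.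
apply: (dP h); first by rewrite h0.
  rewrite -(ler_pM2l h0) nquot.
  have := speed_bound t0 (ltW (ltr_pwDr h0 (lexx t)) : t <= t + h) thT (G_velocity tT').
  rewrite (_ : t + h - t = h); last by ring.
  have : h * (h * (2 * M * B)) <= h * d by rewrite ler_pM2l//; lra.
  lra.
move=> c v cv vM cM; rewrite -(ler_pM2l h0) -ipZl -quotE.
have := u_evolves cv vM cM (s := t) (t := t + h) (x := u t) t0 _ thT.
rewrite (_ : t + h - t = h); last by ring.
apply; first by lra.
  by rewrite subrr normr0 mulr_ge0// ltW.
rewrite distrC (le_trans (u_lip t0 _ thT))//; first by lra.
by rewrite (_ : t + h - t = h)//; ring.
Qed.

(** The translate [p |-> u (p + h)] satisfies the same differential inclusion from the right,
since the right derivative of [u] depends on the position only. *)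
Lemma translation_growth s t h : 0 <= s -> s <= t -> 0 <= h -> t + h <= T ->
  `|u (t + h) - u t| <= expR (K' * (t - s)) * `|u (s + h) - u s|.
Proof.
move=> s0 st h0 thT.
have shAC : absolutely_continuous s t (fun p => u (p + h) - u p).
  apply: AC_sub.
    apply: (AC_lipschitz (K := 2 * M)) => y z sy yz zt.
    rewrite (_ : z - y = (z + h) - (y + h)); last by ring.
    apply: u_lip; lra.
  apply: (AC_lipschitz (K := 2 * M)) => y z sy yz zt; apply: u_lip; lra.
have K2 : 0 <= 2 * K' by rewrite mulr_ge0.
have := gronwall_sqr_norm Hip st K2 (lexx 0) shAC (B := 2 * M * h) _
  (negligible_set0 (@lebesgue_measure R)).
move=> /(_ _ _)/wrap[].
- move=> p /andP[sp pt].
  rewrite (_ : 2 * M * h = 2 * M * (p + h - p)); last by ring.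
  apply: u_lip; lra.
- move=> p /andP[sp pt] _; exists (G (u (p + h)) - G (u p)).
  have ph : 0 <= p + h <= T by apply/andP; split; lra.
  have pT : 0 <= p <= T by apply/andP; split; lra.
  split.
    apply: right_deriv_sub; last by apply: evolution_right_deriv; lra.
    move=> e e0.
    have [d [d0 ud]] := evolution_right_deriv (t := p + h) ltac:(lra) ltac:(lra) e0.
    by exists d; split => // k kd; have := ud k kd; rewrite (addrAC p h).
  have [gN gf _] := G_velocity ph; have [gN' gf' _] := G_velocity pT.
  have := one_sided_lipschitz Hip r_gt0 f_lip gN gN'
    (le_trans gf (u_M ph)) (le_trans gf' (u_M pT)).
  rewrite !subKr -/K' (ipC ip (G _ - _)) addr0; lra.
rewrite mul0r addr0 => h1.
rewrite -ler_sqr ?nnegrE ?mulr_ge0 ?expR_ge0//; apply: (le_trans h1).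
rewrite exprMn (_ : expR (2 * K' * (t - s)) = expR (K' * (t - s)) ^+ 2)//.
by rewrite expr2 -expRD; congr (expR _); ring.
Qed.

(** Divide [translation_growth] by [h] and let [h] tend to 0. *)
Lemma velocity_norm_growth s t : 0 <= s -> s <= t -> t < T ->
  `|G (u t)| <= expR (K' * (t - s)) * `|G (u s)|.
Proof.
move=> s0 st tT; set E := expR _.
have E0 : 0 <= E by exact: expR_ge0.
apply/ler_addgt0Pr => e e0.
have e1 : 0 < e / (E + 1) by rewrite divr_gt0// ltr_wpDl.
have [d [d0 ud]] := evolution_right_deriv (le_trans s0 st) tT e1.
have [d' [d'0 ud']] := evolution_right_deriv s0 (le_lt_trans st tT) e1.
pose h := Num.min (Num.min d d') (T - t) / 2.
have m0 : 0 < Num.min (Num.min d d') (T - t) by rewrite !lt_min d0 d'0 subr_gt0.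
have h0 : 0 < h by rewrite divr_gt0.
have hh : h + h <= Num.min (Num.min d d') (T - t) by rewrite -splitr.
move: hh; rewrite !le_min => /andP[/andP[hd hd'] hT].
clearbody h.
have tg := translation_growth s0 st (ltW h0) (ltac:(lra) : t + h <= T).
have h1 := ud h ltac:(apply/andP; split; lra).
have h2 := ud' h ltac:(apply/andP; split; lra).
have h3 : h * `|G (u t)| <= `|u (t + h) - u t| + e / (E + 1) * h.
  have <- : `|h *: G (u t)| = h * `|G (u t)| by rewrite normrZ gtr0_norm.
  have -> : h *: G (u t) = (u (t + h) - u t) - (u (t + h) - u t - h *: G (u t)).
    by rewrite subKr.
  by rewrite (le_trans (ler_normB _ _))// lerD2l.
have h4 : `|u (s + h) - u s| <= h * `|G (u s)| + e / (E + 1) * h.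
  have <- : `|h *: G (u s)| = h * `|G (u s)| by rewrite normrZ gtr0_norm.
  have -> : u (s + h) - u s = h *: G (u s) + (u (s + h) - u s - h *: G (u s)).
    by rewrite subrKC.
  by rewrite (le_trans (ler_normD _ _))// lerD2l.
have h5 : E * `|u (s + h) - u s| <= E * (h * `|G (u s)| + e / (E + 1) * h).
  by rewrite ler_wpM2l.
have h6 : e / (E + 1) * (E + 1) = e by rewrite divfK// gt_eqF// ltr_wpDl.
rewrite -(ler_pM2l h0); rewrite -/E in tg.
have h7 : h * (e / (E + 1) * (E + 1)) = h * e by rewrite h6.
move: tg h3 h5 h7; move: (e / (E + 1)) => x1; clearbody E => *; lra.
Qed.

Lemma evolution_left_deriv t : 0 < t -> t < T ->
  (forall e : R, 0 < e -> exists s, [/\ 0 <= s, s < t &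
     forall p, s <= p < t -> `|G (u p)| <= `|G (u t)| + e]) ->
  forall e : R, 0 < e -> exists d : R, 0 < d /\
    forall h, 0 < h < d -> `|u t - u (t - h) - h *: G (u t)| <= e * h.
Proof.
move=> t0 tT tcont e e0.
have tT' : 0 <= t <= T by rewrite !ltW.
have [d [d0 dP]] := velocity_attracts (u_C tT') (u_M tT') (G_velocity tT') e0.
have d2 : 0 < d / 2 by rewrite divr_gt0.
have [s [s0 st sG]] := tcont _ d2.
have Z0 : 0 < 2 * M * B + 1 by rewrite ltr_wpDl// mulr_ge0.
exists (Num.min (Num.min d (t - s)) (d / 2 / (2 * M * B + 1))); split.
  by rewrite !lt_min d0 subr_gt0 st divr_gt0.
move=> h /andP[h0]; rewrite !lt_min ltr_pdivlMr// => /andP[/andP[hd hs] hZ].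
have th0 : 0 <= t - h by lra.
have thE : t - (t - h) = h by ring.
have tht : t - h <= t by lra.
have thT : 0 <= t - h <= T by apply/andP; split; lra.
have quotE : u t - u (t - h) = h *: (h^-1 *: (u t - u (t - h))).
  by rewrite scalerA mulfV ?gt_eqF// scale1r.
have nquot : h * `|h^-1 *: (u t - u (t - h))| = `|u t - u (t - h)|.
  by rewrite [in RHS]quotE [RHS]normrZ gtr0_norm.
rewrite [X in X - _]quotE -scalerBr normrZ gtr0_norm// mulrC ler_pM2r//.
apply: (dP h); first by rewrite h0.
  rewrite -(ler_pM2l h0) nquot.
  have := speed_bound th0 tht (ltW tT) (G_velocity thT); rewrite thE.
  have : h * (h * (2 * M * B)) <= h * (d / 2) by rewrite ler_pM2l//; lra.
  have : h * `|G (u (t - h))| <= h * (`|G (u t)| + d / 2).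
    by rewrite ler_pM2l//; apply: sG; apply/andP; split; lra.
  lra.
move=> c v cv vM cM; rewrite -(ler_pM2l h0) -ipZl -quotE.
have := u_evolves cv vM cM (s := t - h) (t := t) (x := u t) th0 tht (ltW tT).
rewrite thE; apply.
  by rewrite (le_trans (u_lip th0 tht (ltW tT)))// thE.
by rewrite subrr normr0 mulr_ge0// ltW.
Qed.

End Differentiability.

(** * Existence and uniqueness *)

(** A rational number chosen in each jump determines the jump. *)
Lemma countable_left_jumps {R : realType} (m : R -> R) (a b : R) :
  (forall s t, a <= s -> s <= t -> t < b -> m t <= m s) ->
  countable [set t | a < t < b /\ exists e : R, 0 < e /\
    forall s, a <= s < t -> m t + e <= m s].
Proof.
move=> m_mono; set J := [set t | _].
have ratP t : exists q : rat, J t ->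
    m t < ratr q /\ forall s, a <= s < t -> ratr q < m s.
  (* Off the jump set the value is arbitrary. *)
  have [[_ [e [e0 te]]]|nJ] := pselect (J t); last by exists 0 => /nJ.
  have jump : m t < m t + e by rewrite ltrDl.
  have [q /[!in_itv]/= /andP[mq qm]] := rat_in_itvoo jump.
  by exists q => _; split => // s /te; exact: lt_le_trans.
have [g gP] := choice ratP.
have g_inj s t : J s -> J t -> s < t -> g s != g t.
  move=> Js Jt st; have [sq _] := gP s Js; have [_ qt] := gP t Jt.
  have [/andP[as_ _] _] := Js.
  have := qt s ltac:(by rewrite ltW); apply: contraTneq => gst; rewrite -leNgt.
  by rewrite -gst ltW.
apply/countable_injP; exists (pickle \o g) => s t /set_mem Js /set_mem Jt.
move=> /(pcan_inj pickleK) gst; apply/eqP; case: ltgtP => // ts; exfalso.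
  by move/eqP: (g_inj _ _ Js Jt ts); rewrite gst.
by move/eqP: (g_inj _ _ Jt Js ts); rewrite gst.
Qed.

Section Existence.
Context {R : realType} {H : completeNormedModType R} (ip : {dot H for (@idfun R)}).
Hypothesis Hip : norm_from_dot ip.
Variables (r : R) (C : set H) (f : H -> H) (T L K : R) (u0 : H).
Hypotheses (r_gt0 : 0 < r) (C_closed : closed C) (T_gt0 : 0 < T).
Hypothesis C_prox : prox_regular r f C.
Hypotheses (L_gt0 : 0 < L) (K_ge0 : 0 <= K).
Hypothesis f_growth : forall x, `|f x| <= L * (1 + `|x|).
Hypothesis f_lip : forall x y, `|f x - f y| <= K * `|x - y|.
Hypothesis Cu0 : C u0.
Notation mu := (@lebesgue_measure R).

(** The left jumps of the nonincreasing function [exp(- k t) |g(u t)|] are countably many;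
at every other interior time [u] is derivable with derivative [g(u t)]. *)
Lemma solution_exists : exists u : R -> H,
  is_solution T f C u0 u /\ forall t, 0 <= t <= T -> C (u t).
Proof.
pose M := speed T L u0; pose rad := radius T L u0.
have M_gt0 : 0 < M by exact: speed_gt0.
have field_le x : 1 + `|x| <= rad -> `|f x| <= M by exact: field_le_speed.
have approx_ex e : 0 < e -> exists w, approx_solution ip r C f T M rad u0 e w.
  exact: (approx_solution_exists Hip T r_gt0 C_prox L_gt0 K_ge0 f_growth f_lip Cu0).
have [u [w [eps [eps0 epsI wP wu]]]] :=
  limit_exists Hip r_gt0 T_gt0 M_gt0 K_ge0 field_le f_lip approx_ex.
have u_start := limit_start T_gt0 wP wu.
have u_C := limit_in_C C_closed T_gt0 M_gt0 eps0 epsI wP wu.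
have u_rad := limit_radius T_gt0 M_gt0 eps0 epsI wP wu.
have u_lip := limit_lipschitz wP wu.
have [B [B0 u_ev]] := limit_evolves Hip r_gt0 T_gt0 M_gt0 K_ge0 field_le f_lip eps0 epsI wP wu.
have u_M t (tT : 0 <= t <= T) : `|f (u t)| <= M by apply: field_le; exact: u_rad.
have G_ex x : exists g, C x -> projected_velocity ip r C f x g.
  have [Cx|nCx] := pselect (C x); last by exists 0.
  by have [g gP] := projected_velocity_exists Hip r_gt0 C_closed C_prox Cx; exists g.
have [G GP] := choice G_ex.
have G_vel t (tT : 0 <= t <= T) : projected_velocity ip r C f (u t) (G (u t)).
  by apply: GP; exact: u_C.
clearbody M rad.
exists u; split => //; split => //; first by apply: AC_lipschitz => s t; exact: u_lip.
pose k := one_sided_const r M K.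
have k0 : 0 <= k by exact: one_sided_const_ge0.
pose m t := expR (- (k * t)) * `|G (u t)|.
have m_mono s t : 0 <= s -> s <= t -> t < T -> m t <= m s.
  move=> s0 st tT; rewrite /m.
  have := velocity_norm_growth Hip r_gt0 M_gt0 K_ge0 B0 f_lip u_C u_M u_lip u_ev G_vel s0 st tT.
  rewrite -/k -(ler_pM2l (expR_gt0 (- (k * t)))) => /le_trans; apply.
  rewrite mulrA -expRD le_eqVlt; apply/orP; left; apply/eqP.
  by congr (expR _ * _); ring.
have J_countable := countable_left_jumps m_mono.
set J := [set t | _] in J_countable.
have J0 := countable_lebesgue_measure0 J_countable.
have pt0 (x : R) : mu.-negligible [set x].
  by exists [set x]; split => //; exact: lebesgue_measure_set1.
have JN : mu.-negligible J.
  by exists J; split => //; apply: countable_measurable J_countable.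
apply: (negligibleS _ (negligibleU JN (negligibleU (pt0 0) (pt0 T)))) => t /=.
apply: contra_notP => /not_orP[nJ /not_orP[/eqP tn0 /eqP tnT]].
rewrite in_itv/= => /andP[t0 tT].
have {tn0}t0 : 0 < t by rewrite lt_neqAle eq_sym tn0.
have {tnT}tT : t < T by rewrite lt_neqAle tnT.
have tT' : 0 <= t <= T by rewrite !ltW.
have t_left e : 0 < e -> exists s, [/\ 0 <= s, s < t &
     forall p, s <= p < t -> `|G (u p)| <= `|G (u t)| + e].
  move=> e0; apply: contrapT => nex; apply: nJ; split; first by rewrite t0.
  exists (expR (- (k * T)) * e); split; first by rewrite mulr_gt0 ?expR_gt0.
  move=> s /andP[s0 st]; rewrite leNgt; apply/negP => ms.
  apply: nex; exists s; split => // p /andP[sp pt].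
  have mp : m p <= m t + expR (- (k * T)) * e.
    by rewrite (le_trans (m_mono _ _ s0 sp _)) ?ltW// (lt_trans pt).
  have Ep : 0 < expR (k * p) by exact: expR_gt0.
  have h1 : `|G (u p)| = expR (k * p) * m p.
    by rewrite /m mulrA -expRD subrr expR0 mul1r.
  rewrite h1; apply: (@le_trans _ _ (expR (k * p) * (m t + expR (- (k * T)) * e))).
    by rewrite ler_pM2l.
  rewrite mulrDr lerD//.
    rewrite /m mulrA -expRD ler_piMl// -expR0 ler_expR subr_le0 ler_wpM2l// ltW//.
  rewrite mulrA -expRD ler_piMl ?(ltW e0)// -expR0 ler_expR subr_le0 ler_wpM2l//.
  by rewrite ltW// (lt_trans pt).
have left := evolution_left_deriv Hip M_gt0 K_ge0 B0 f_lip u_C u_M u_lip u_ev G_vel t0 tT t_left.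
have right := evolution_right_deriv Hip M_gt0 K_ge0 B0 f_lip u_C u_M u_lip u_ev G_vel (ltW t0) tT.
have [ut Dut] : derivable u t 1 /\ 'D_1 u t = G (u t).
  apply/derive_epsP => e e0.
  have [d [d0 ud]] := left e e0; have [d' [d'0 ud']] := right e e0.
  exists (Num.min d d'); split; first by rewrite lt_min d0.
  move=> h h0; rewrite lt_min => /andP[hd hd'].
  move: h0; rewrite neq_lt => /orP[h0|h0].
    have := ud (- h); rewrite opprK -(ltr0_norm h0) hd normr_gt0 lt_eqF//.
    move=> /(_ isT); rewrite (ltr0_norm h0) scaleNr opprK => uh.
    by rewrite -normrN opprB opprB addrC.
  have := ud' h; rewrite h0 -{1}(gtr0_norm h0) hd' => /(_ isT).
  by rewrite (gtr0_norm h0).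
split => //; exists (f (u t) - G (u t)); last by rewrite Dut subrKC.
have [gN _ _] := G_vel t tT'.
exact: (hyponormal_proximal Hip r_gt0 gN).
Qed.

End Existence.

Theorem theorem1p2 (R : realType) (H : completeNormedModType R)
  (ip : {dot H for (@idfun R)}) (Hip : norm_from_dot ip)
  (Hsep : separable H)
  (T : R) (T_ge0 : 0 <= T)
  (f : H -> H) (f_lip : [lipschitz f x | x in [set: H]])
  (f_growth : linear_growth f)
  (r : R) (r_gt0 : 0 < r)
  (C : set H) (C_neq0 : C !=set0) (C_closed : closed C)
  (C_prox : prox_regular r f C)
  (u0 : H) (Cu0 : C u0) :
  exists u : R -> H,
    [/\ is_solution T f C u0 u,
        forall w : R -> H, is_solution T f C u0 w ->
          forall t : R, `[0, T]%classic t -> w t = u t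
      & forall t : R, `[0, T]%classic t -> C (u t)].
Proof.
have [L [L_gt0 fL]] := f_growth.
have [K [K_ge0 fK]] : exists K : R, 0 <= K /\
    forall x y, `|f x - f y| <= K * `|x - y|.
  have [K0 [_ K0P]] := f_lip.
  exists (`|K0| + 1); split; first by rewrite addr_ge0.
  move=> x y; apply: (K0P (`|K0| + 1) _ (x, y)) => //.
  by rewrite (le_lt_trans (ler_norm K0))// ltrDl.
(* Solving up to [T + 1] covers the degenerate interval [T = 0] as well. *)
have T1_gt0 : 0 < T + 1 by rewrite ltr_wpDl.
have [u [[uAC uD u_start] uC]] :=
  solution_exists Hip r_gt0 C_closed T1_gt0 C_prox L_gt0 K_ge0 fL fK Cu0.
have usol : is_solution T f C u0 u.
  split=> //; first by apply: AC_subitv uAC => //; rewrite lerDl.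
  apply: negligibleS uD => t /=; apply: contra_not => uDt tT; apply: uDt.
  move: tT; rewrite !in_itv/= => /andP[-> tT] /=.
  by rewrite (le_trans tT)// lerDl.
exists u; split => // [w wsol t|t]; rewrite /= in_itv/= => /andP[t0 tT].
  move: (T_ge0); rewrite le_eqVlt => /predU1P[T0|T_gt0].
    have -> : t = 0 by apply/eqP; rewrite eq_le t0 T0 tT.
    by have [_ _ ->] := wsol.
  apply: (solution_unique Hip r_gt0 C_closed T_gt0 C_prox (ltW L_gt0) K_ge0 fL fK
    wsol usol).
  by rewrite t0.
by apply: uC; rewrite t0 (le_trans tT)// lerDl.
Qed.
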